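(* For every integer $r\ge1$, the coefficient of $x^2$ in $P_{01r}(x)$ is positive and equals \[ 4^r \Biggl( \frac 14 \left[{r \atop 1}\right] -\frac 1{24} \left[{r \atop 2}\right]+\frac 12 \sum_{1\le i\le r/2} \left[{r \atop 2i}\right]\binom{2i}{i} \left(\frac{B_i}{i}\Bigl(1-(-1)^i B_i \Bigr) \right)^2 +\sum_{i=1}^{r} \sum_{j=i+1}^{r} \left[{r \atop i+j}\right]\binom{i+j}{i} \frac{B_i}{i}\Bigl(1-(-1)^i B_i\Bigr) \frac{B_j}{j}\Bigl(1-(-1)^j B_j\Bigr) \Biggr). \]
   Context: The Bernoulli numbers $B_n$ are defined by $\frac{z}{e^z-1}=\sum_{n\ge0}B_n\frac{z^n}{n!}$. For $m\ge0$, $s_m(x):=\frac{1}{m+1}\sum_{j=0}^m \binom{m+1}{j+1}(-1)^{m-j}B_{m-j}x^{j+1}$ (so $s_m(N)=1^m+\cdots+N^m$). $\left[{r \atop m}\right]$ is the unsigned Stirling number of the first kind, $x(x+1)\cdots(x+r-1)=\sum_m\left[{r \atop m}\right]x^m$ (zero if $m>r$). For $r\ge1$, $P_{01r}(x) := 4^r \sum_{m=0}^r (-1)^m \left[{r \atop m}\right] m! \sum_{1j_1+ \cdots + m j_{m} = m}\frac{1}{j_1! \cdots j_m!}\prod_{i=1}^{m}\left(\frac{(-1)^{i-1}B_{i}}{i \cdot i!}(s_{i}(x)-x) \right)^{j_{i}}$, the inner sum over tuples of nonnegative integers. (This polynomial satisfies $P_{01r}(N)=(-1)^N N!(-4)^r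 r!\,C_{01(N-r)}(N)$ for integers $N\ge r+1$, where $C_{01\ell}(N)$ is the coefficient of $(q-1)^{-\ell}$ in the partial fraction decomposition of $\prod_{j=1}^N(1-q^j)^{-1}$.) *)

(* Defs.v *)
From HB Require Import structures.
From mathcomp Require Import all_boot all_order all_algebra.
Set Implicit Arguments.
Unset Strict Implicit.
Unset Printing Implicit Defensive.
Import Order.TTheory GRing.Theory Num.Theory.
Local Open Scope ring_scope.

(* A formal power series over rat is the sequence of its coefficients. *)
Definition psmul (a b : nat -> rat) : nat -> rat :=
  fun n => \sum_(k < n.+1) a k * b (n - k)%N.

Definition psone : nat -> rat := fun n => (n == 0)%:R.

Definition psX : nat -> rat := fun n => (n == 1)%:R.

(* The first n coefficients of 1 / a (when a 0 != 0), computed from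
   psmul a (1 / a) = 1. *)
Fixpoint psinv_seq (a : nat -> rat) (n : nat) : seq rat :=
  if n is k.+1 then
    let s := psinv_seq a k in
    rcons s ((a 0)^-1 * (psone k - \sum_(i < k) s`_i * a (k - i)%N))
  else [::].

Definition psinv (a : nat -> rat) : nat -> rat :=
  fun n => (psinv_seq a n.+1)`_n.

Lemma size_psinv_seq a n : size (psinv_seq a n) = n.
Proof. by elim: n => //= n IHn; rewrite size_rcons IHn. Qed.

Lemma nth_psinv_seq a n i : (i < n)%N -> (psinv_seq a n)`_i = psinv a i.
Proof.
elim: n => // n IHn; rewrite ltnS leq_eqVlt => /orP[/eqP -> //|lt_in].
by rewrite /= nth_rcons size_psinv_seq lt_in IHn.
Qed.

Lemma psinvE a n :
  psinv a n = (a 0)^-1 * (psone n - \sum_(i < n) psinv a i * a (n - i)%N).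
Proof.
rewrite {1}/psinv /= nth_rcons size_psinv_seq ltnn eqxx.
by congr (_ * (_ - _)); apply: eq_bigr => i _; rewrite nth_psinv_seq.
Qed.

Lemma psmul_psinv a n : a 0 != 0 -> psmul (psinv a) a n = psone n.
Proof.
move=> a0; rewrite /psmul big_ord_recr /= subnn [psinv a n]psinvE.
by rewrite mulrAC mulVf // mul1r addrC subrK.
Qed.

(* The series (e^z - 1) / z. *)
Definition expm1_divX : nat -> rat := fun n => (n.+1)`!%:R^-1.

(* z / (e^z - 1) = \sum_n B_n z^n / n!, so that B_1 = - 1/2. *)
Definition bernoulli (n : nat) : rat := n`!%:R * psinv expm1_divX n.

(* The series e^z - 1. *)
Definition expm1 : nat -> rat := fun n => n`!%:R^-1 - psone n.

Lemma bernoulli_gf n :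
  psmul (fun k => bernoulli k / k`!%:R) expm1 n = psX n.
Proof.
have fN0 k : k`!%:R != 0 :> rat by rewrite pnatr_eq0 -lt0n fact_gt0.
case: n => [|n]; first by rewrite /psmul big_ord1 /expm1 /psone /= subrr mulr0.
rewrite /psmul big_ord_recr /= subnn {2}/expm1 /psone fact0 invr1 subrr mulr0.
rewrite addr0 /psX eqSS -[RHS](@psmul_psinv expm1_divX n) ?invr_eq0 //.
apply: eq_bigr => i _.
have le_in : (i <= n)%N by rewrite -ltnS.
rewrite /bernoulli [_ * psinv _ _]mulrC mulfK // subSn //.
by rewrite /expm1 /expm1_divX /psone subr0.
Qed.

(* power_sum m evaluated at N is 1 ^ m + ... + N ^ m. *)
Definition power_sum (m : nat) : {poly rat} :=
  (m.+1)%:R^-1 *: \sum_(j < m.+1)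
    ('C(m.+1, j.+1)%:R * (-1) ^+ (m - j) * bernoulli (m - j)) *: 'X^(j.+1).

(* Unsigned Stirling numbers of the first kind, embedded in rat: the
   coefficient of x^m in x (x + 1) ... (x + r - 1). *)
Definition stirling1 (r m : nat) : rat :=
  (\prod_(i < r) ('X + i%:R%:P) : {poly rat})`_m.

(* The ordinal i : 'I_m stands for the index i + 1 of the product and of the
   tuple (j_1, ..., j_m).  The constraint on the tuple forces j_i <= m, so
   ranging over 'I_m.+1 loses nothing. *)
Definition P01 (r : nat) : {poly rat} :=
  (4 ^+ r) *: \sum_(m < r.+1) ((-1) ^+ m * stirling1 r m * m`!%:R) *:
    \sum_(j : {ffun 'I_m -> 'I_m.+1} | (\sum_(i < m) i.+1 * j i)%N == m)
      (\prod_(i < m) (j i)`!%:R)^-1 *: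
      \prod_(i < m)
        (((-1) ^+ i * bernoulli i.+1 / (i.+1%:R * (i.+1)`!%:R))
           *: (power_sum i.+1 - 'X)) ^+ j i.

(* Main.v *)
(* Every factor of the inner sum vanishes at x = 0, so only tuples of weight
   one or two contribute to x^2: writing e_i = B_i (1 - (-1)^i B_i) / (i i!), the
   coefficient is 4^r \sum_m m! [r m] c_m where, up to corrections at m = 1, 2,
   c_m is half the m-th convolution square of e.  Regrouping gives the formula.

   For positivity, e_1 = -1/4, the other odd terms vanish, and d_n = -e_(2n+2)
   is positive for n >= 5 and satisfies 9 d_(n+1) >= 5 d_n for n >= 15; both
   follow from the Riccati equation of z / (e^z - 1), which gives Euler's
   quadratic recursion for |B_2n| / (2n)!.  Then c_(2n+3) = d_n / 4 > 0, while
   c_(2n+4) >= - 5/144 d_n is the only possible source of negative terms of large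
   index.  Elementary bounds for consecutive Stirling numbers [r m] show that, when
   m = 2n+4 >= 42, such a term is compensated by half of the next term if
   r >= 2m and by half of the previous one otherwise.  There remains the sum over
   m <= 41 with half of the last term.  It is evaluated for r <= 96; for larger r
   the term m = 41 dominates the negative ones, since this is so at r = 96 and the
   ratios [r m] / [r 41] decrease with r. *)

From HB Require Import structures.
Require Import Defs.
From Stdlib Require ZArith QArith Qreduction.
From mathcomp Require Import all_boot all_order all_algebra.
From mathcomp Require Import ring lra zify.
Import Order.TTheory GRing.Theory Num.Theory.
Local Open Scope ring_scope.

(** * The coefficient of x^2 of an exponential *)

(** The second elementary symmetric function of the linear coefficients is half of the square of
    their sum minus the sum of their squares. Doubling avoids both the division and a sum over
    pairs. *)
Lemma coef_prod_coef0_1 (R : comNzRingType) (I : Type) (s : seq I)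
    (Q : I -> {poly R}) (P := \prod_(i <- s) Q i) :
  (forall i, (Q i)`_0 = 1) ->
  [/\ P`_0 = 1, P`_1 = \sum_(i <- s) (Q i)`_1
    & 2 * P`_2 + \sum_(i <- s) (Q i)`_1 ^+ 2
      = 2 * (\sum_(i <- s) (Q i)`_2) + (\sum_(i <- s) (Q i)`_1) ^+ 2].
Proof.
move=> Q0; rewrite {}/P; elim: s => [|i s [IH0 IH1 IH2]].
  by rewrite !big_nil !coef1 /=; split=> //; ring.
rewrite !big_cons !coefM !big_ord_recl !big_ord0 /= /bump /= !add1n !subn0.
rewrite Q0 IH0 IH1; split; [by rewrite mul1r addr0|by ring|].
move: IH2; set P2 := _`_2; set S1 := \sum_(i <- s) _ `_1.
set S2 := \sum_(i <- s) _ `_2; set S11 := \sum_(i <- s) _ ^+ 2 => IH2.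
have -> : S11 = 2 * S2 + S1 ^+ 2 - 2 * P2 by rewrite -IH2; ring.
by ring.
Qed.

(** As [p] is divisible by x, [p ^+ k] is divisible by x^k, so only exponents up to 2 matter. *)
Lemma coef_exp_coef0_0 (R : comNzRingType) (p : {poly R}) (k : nat) :
  p`_0 = 0 ->
  [/\ (p ^+ k)`_0 = (k == 0)%:R, (p ^+ k)`_1 = (k == 1)%:R * p`_1
    & (p ^+ k)`_2 = (k == 1)%:R * p`_2 + (k == 2)%:R * p`_1 ^+ 2].
Proof.
move=> p0; elim: k => [|k [IH0 IH1 IH2]].
  by rewrite expr0 !coef1 /= !mul0r addr0.
rewrite exprS !coefM !big_ord_recl !big_ord0 /= /bump /= !add1n.
rewrite /subn /= p0 IH0 IH1 !eqSS.
by split; case: k {IH0 IH1 IH2} => [|[|k]] /=; ring.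
Qed.

Lemma sum_ord_delta (R : nzRingType) n k (F : nat -> R) :
  \sum_(i < n) ((i : nat) == k)%:R * F i = (k < n)%:R * F k.
Proof.
case: ltnP => [lt_kn|le_nk].
  rewrite (bigD1 (Ordinal lt_kn)) //= eqxx big1 ?addr0 // => i.
  by rewrite -val_eqE /= => /negPf ->; rewrite mul0r.
rewrite mul0r big1 // => i _; case: eqP => [ik|]; last by rewrite mul0r.
by move: (ltn_ord i); rewrite ik ltnNge le_nk.
Qed.

Lemma double_coef2 (a b c d : rat) :
  a *+ 2 + c = (b + 1 / 2 * c) *+ 2 + d -> a = b + 1 / 2 * d.
Proof. lra. Qed.

(* The left-hand side is the coefficient of u^m in exp (\sum_i p_i u^(i+1)).
   To extract it, the factors exp (p_i u^(i+1)) are multiplied in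
   {poly {poly rat}}, with u the inner and x the outer variable. *)
Lemma coef2_exp_sum m (p : 'I_m -> {poly rat}) :
  (forall i, (p i)`_0 = 0) ->
  (\sum_(j : {ffun 'I_m -> 'I_m.+1} | (\sum_(i < m) i.+1 * j i)%N == m)
     (\prod_(i < m) (j i)`!%:R)^-1 *: \prod_(i < m) p i ^+ j i)`_2
  = \sum_(i < m) (i.+1 == m)%:R * (p i)`_2
    + 1 / 2 * (\sum_(i < m) \sum_(k < m)
                 (i.+1 + k.+1 == m)%N%:R * ((p i)`_1 * (p k)`_1)).
Proof.
move=> p0.
pose T i k : {poly {poly rat}} :=
  map_poly polyC (k`!%:R^-1 *: p i ^+ k) * ('X^(i.+1 * k))%:P.
pose Q i := \sum_(k < m.+1) T i k.
have coefT i k n : (T i k)`_n = ((k`!%:R^-1 * (p i ^+ k)`_n)%:P * 'X^(i.+1 * k)).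
  by rewrite /T coefMC coef_map /= coefZ.
have Q0 i : (Q i)`_0 = 1.
  rewrite coef_sum big_ord_recl coefT big1 ?addr0 => [|k _].
    by rewrite fact0 invr1 expr0 coef1 muln0 expr0 !mulr1.
  by rewrite coefT; have [-> _ _] := coef_exp_coef0_0 _ _ (bump 0 k) (p0 i);
    rewrite mulr0 mul0r.
(* Truncating the exponential at exponent m keeps its linear term, but the quadratic one only if 1 <
   m; hence the boolean factor in [Q2]. *)
have m_gt0 (i : 'I_m) : (0 < m)%N by apply: leq_ltn_trans (ltn_ord i).
have Q1 i : (Q i)`_1 = (p i)`_1 *: 'X^(i.+1).
  rewrite coef_sum.
  under eq_bigr => k _.
    rewrite coefT; have [_ -> _] := coef_exp_coef0_0 _ _ k (p0 i).
    rewrite mulrCA polyCM polyC_natr -mulrA.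
    over.
  rewrite (sum_ord_delta _ _ _ (fun k => (k`!%:R^-1 * (p i)`_1)%:P * 'X^(i.+1 * k))).
  by rewrite ltnS (m_gt0 i) mul1r muln1 invr1 mul1r mul_polyC.
have Q2 i : (Q i)`_2 = (p i)`_2 *: 'X^(i.+1)
   + (1 < m)%N%:R * ((1 / 2 * (p i)`_1 ^+ 2) *: 'X^(i.+1 * 2)).
  rewrite coef_sum.
  under eq_bigr => k _.
    rewrite coefT; have [_ _ ->] := coef_exp_coef0_0 _ _ k (p0 i).
    rewrite mulrDr polyCD mulrDl (mulrCA k`!%:R^-1 _ (p i)`_2).
    rewrite (mulrCA k`!%:R^-1 _ ((p i)`_1 ^+ 2)).
    rewrite !(polyCM (_ == _)%:R) !polyC_natr -!mulrA.
    over.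
  rewrite big_split /=.
  rewrite (sum_ord_delta _ _ _ (fun k => (k`!%:R^-1 * (p i)`_2)%:P * 'X^(i.+1 * k))).
  rewrite (sum_ord_delta _ _ _ (fun k => (k`!%:R^-1 * (p i)`_1 ^+ 2)%:P * 'X^(i.+1 * k))).
  by rewrite !ltnS (m_gt0 i) mul1r muln1 -!mul_polyC mul1r invr1 !mul1r.
have [_ _] := coef_prod_coef0_1 _ _ (index_enum _) Q Q0.
have -> : (\prod_i Q i)`_2 = \sum_(j : {ffun 'I_m -> 'I_m.+1})
   ((\prod_(i < m) (j i)`!%:R)^-1 * (\prod_(i < m) p i ^+ j i)`_2)
     *: 'X^(\sum_(i < m) i.+1 * j i).
  rewrite bigA_distr_bigA coef_sum; apply: eq_bigr => j _.
  rewrite /T big_split /= -rmorph_prod /= -rmorph_prod /=.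
  rewrite -(big_morph _ (exprD _) (expr0 _)) coefMC coef_map /=.
  rewrite -mul_polyC; congr (_%:P * _).
  under eq_bigr do rewrite -mul_polyC.
  by rewrite big_split /= -rmorph_prod /= mul_polyC coefZ prodfV.
(* Taking the coefficient of u^m selects the tuples of weight m. *)
move=> /(congr1 (fun q : {poly rat} => q`_m)).
rewrite !coefD !mulr_natl !coefMn.
have -> : (\sum_i (Q i)`_1 ^+ 2)`_m = \sum_(i < m) (i.+1 * 2 == m)%N%:R * (p i)`_1 ^+ 2.
  rewrite coef_sum; apply: eq_bigr => i _.
  by rewrite Q1 exprZn -exprM coefZ coefXn mulrC eq_sym.
have -> : (\sum_i (Q i)`_2)`_m = \sum_(i < m) (i.+1 == m)%:R * (p i)`_2
    + 1 / 2 * (\sum_(i < m) (i.+1 * 2 == m)%N%:R * (p i)`_1 ^+ 2).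
  rewrite coef_sum mulr_sumr -big_split /=; apply: eq_bigr => i _.
  rewrite Q2 coefD mulr_natl coefMn !coefZ !coefXn !(eq_sym m).
  (* If m <= 1 the factor [1 < m] vanishes, but then [i.+1 * 2 == m] fails as well. *)
  case: eqP => [_|_]; case: eqP => [<-|_]; rewrite /= ?muln2 ?ltnS //= ?mul0rn; ring.
have -> : ((\sum_i (Q i)`_1) ^+ 2)`_m = \sum_(i < m) \sum_(k < m)
    (i.+1 + k.+1 == m)%N%:R * ((p i)`_1 * (p k)`_1).
  rewrite expr2 big_distrlr /= coef_sum; apply: eq_bigr => i _.
  rewrite coef_sum; apply: eq_bigr => k _.
  rewrite !Q1 -scalerAl -scalerAr scalerA -exprD coefZ coefXn mulrC eq_sym.
  by [].
have -> : (\sum_(j : {ffun 'I_m -> 'I_m.+1})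
     ((\prod_(i < m) (j i)`!%:R)^-1 * (\prod_(i < m) p i ^+ j i)`_2)
     *: 'X^(\sum_(i < m) i.+1 * j i))`_m =
   (\sum_(j : {ffun 'I_m -> 'I_m.+1} | (\sum_(i < m) i.+1 * j i)%N == m)
     (\prod_(i < m) (j i)`!%:R)^-1 *: \prod_(i < m) p i ^+ j i)`_2.
  rewrite !coef_sum [RHS]big_mkcond; apply: eq_bigr => j _.
  by rewrite coefZ coefXn eq_sym; case: eqP; rewrite ?coefZ ?mulr1 ?mulr0.
exact: double_coef2.
Qed.

(** The factor that the stated formula attaches to each index. It vanishes at 0, where the inverse
    of 0 is 0, so convolutions of [bern_egf] may start there. *)
Definition bern_term (i : nat) : rat :=
  bernoulli i / i%:R * (1 - (-1) ^+ i * bernoulli i).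

Definition bern_egf (i : nat) : rat := bern_term i / i`!%:R.

(* (-1)^m times the x^2-coefficient of the inner sum of P01. *)
HB.lock Definition inner_coef (m : nat) : rat :=
  (m == 1)%:R / 4 - (m == 2)%:R / 48
  + 1 / 2 * \sum_(i < m.+1) bern_egf i * bern_egf (m - i).

Lemma inner_coefE m : inner_coef m = (m == 1)%:R / 4 - (m == 2)%:R / 48
  + 1 / 2 * \sum_(i < m.+1) bern_egf i * bern_egf (m - i).
Proof. by rewrite inner_coef.unlock. Qed.

Lemma bernoulli0 : bernoulli 0 = 1.
Proof. by rewrite /bernoulli psinvE big_ord0 /psone /expm1_divX /= subr0. Qed.

Lemma bern_egf0 : bern_egf 0 = 0.
Proof. by rewrite /bern_egf /bern_term invr0 mulr0 !mul0r. Qed.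

Lemma coef_power_sum m k : (power_sum m)`_k.+1 =
  m.+1%:R^-1 * ((k < m.+1)%N%:R
    * ('C(m.+1, k.+1)%:R * (-1) ^+ (m - k) * bernoulli (m - k))).
Proof.
rewrite coefZ coef_sum; congr (_ * _).
rewrite -(sum_ord_delta _ _ _ (fun j =>
  'C(m.+1, j.+1)%:R * (-1) ^+ (m - j) * bernoulli (m - j))).
by apply: eq_bigr => i _; rewrite coefZ coefXn eqSS eq_sym mulrC.
Qed.

Lemma coef0_power_sum m : (power_sum m)`_0 = 0.
Proof.
rewrite coefZ coef_sum big1 ?mulr0 // => i _.
by rewrite coefZ coefXn mulr0.
Qed.

(** * Bernoulli numbers *)

(** A coefficient of a product involves finitely many others, so the laws of the polynomial ring
    carry over to series. *)
Lemma psmul_poly N a b n : (n < N)%N ->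
  psmul a b n = (\poly_(i < N) a i * \poly_(i < N) b i)`_n.
Proof.
move=> lt_nN; rewrite coefM; apply: eq_bigr => k _.
have lt_kn := ltn_ord k.
by rewrite !coef_poly (leq_ltn_trans _ lt_nN) ?(leq_ltn_trans _ lt_nN) ?leq_subr.
Qed.

Lemma eq_psmul a a' b b' : a =1 a' -> b =1 b' -> psmul a b =1 psmul a' b'.
Proof. by move=> aE bE n; apply: eq_bigr => k _; rewrite aE bE. Qed.

Lemma psmulC a b : psmul a b =1 psmul b a.
Proof. by move=> n; rewrite !(@psmul_poly n.+1) // mulrC. Qed.

Lemma psmulA a b c : psmul a (psmul b c) =1 psmul (psmul a b) c.
Proof.
move=> n; pose P (f : nat -> rat) := \poly_(i < n.+1) f i.
have PM f g h : psmul f (psmul g h) n = (P f * (P g * P h))`_n.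
  rewrite coefM; apply: eq_bigr => k _; rewrite coef_poly ltn_ord.
  by rewrite (@psmul_poly n.+1) // ltnS leq_subr.
by rewrite [RHS]psmulC !PM mulrA mulrC.
Qed.

Lemma psmulD a b c n : psmul a (fun k => b k + c k) n = psmul a b n + psmul a c n.
Proof. by rewrite -big_split; apply: eq_bigr => k _; rewrite mulrDr. Qed.

Lemma psmulX a n : psmul a psX n.+1 = a n.
Proof.
rewrite psmulC /psmul (sum_ord_delta _ _ _ (fun k => a (n.+1 - k)%N)) /=.
by rewrite mul1r subSS subn0.
Qed.

Lemma psmul1 a : psmul a psone =1 a.
Proof.
move=> n; rewrite psmulC /psmul (sum_ord_delta _ _ _ (fun k => a (n - k)%N)) /=.
by rewrite mul1r subn0.
Qed.

Definition beta (n : nat) : rat := bernoulli n / n`!%:R.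

(* Coefficientwise form of the Riccati equation z f' + z f + f^2 = f for
   f = z / (e^z - 1), obtained by applying z d/dz to f (e^z - 1) = z and
   multiplying by f. *)
Lemma beta_riccati n :
  n.+1%:R * beta n.+1 + beta n + psmul beta beta n.+1 = beta n.+1.
Proof.
pose theta (a : nat -> rat) k := k%:R * a k.
have fE : psmul beta expm1 =1 psX := bernoulli_gf.
(* z d/dz (e^z - 1) = z e^z. *)
have thetaE : theta expm1 =1 psmul psX (fun k => expm1 k + psone k).
  case=> [|k]; first by rewrite psmulC /theta mul0r /psmul big_ord1 /psX mulr0.
  rewrite psmulC psmulX /theta /expm1 /psone /= subr0 subrK factS natrM invfM.
  by rewrite mulrA mulfV ?mul1r ?pnatr_eq0.
(* The Leibniz rule for z d/dz, applied to f (e^z - 1) = z. *)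
have thetaM k :
    psmul (theta beta) expm1 k + psmul beta (theta expm1) k = psX k.
  have <- : theta (psmul beta expm1) k = psX k.
    by rewrite /theta fE /psX; case: eqP => [->|_]; rewrite ?mulr0 ?mulr1.
  rewrite -big_split /theta mulr_sumr; apply: eq_bigr => i _ /=.
  have -> : k%:R = i%:R + (k - i)%:R :> rat by rewrite -natrD subnKC // -ltnS.
  by ring.
rewrite -[RHS](psmulX beta n.+1) -(eq_psmul _ _ _ _ (frefl beta) thetaM) psmulD.
rewrite -addrA; congr (_ + _).
  rewrite psmulC -psmulA (eq_psmul _ _ _ psX (frefl _)) ?psmulX // => k.
  by rewrite psmulC fE.
pose W k := psX k + beta k.
(* f^2 z e^z = z f (z + f), because f e^z = z + f. *)
have -> : psmul beta (psmul beta (theta expm1)) n.+2 = psmul beta (psmul psX W) n.+2.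
  apply: eq_psmul => // k; rewrite (eq_psmul _ beta _ _ (frefl _) thetaE) psmulA.
  rewrite (eq_psmul _ _ _ _ (psmulC beta psX) (frefl _)) -psmulA.
  by apply: eq_psmul => // i; rewrite psmulD fE psmul1.
rewrite [RHS]psmulC -psmulA [RHS]psmulC psmulX [RHS]psmulC psmulD psmulX //.
Qed.

Lemma beta0 : beta 0 = 1.
Proof. by rewrite /beta bernoulli0 divr1. Qed.

Lemma beta1 : beta 1 = - 1 / 2.
Proof.
have := beta_riccati 0; rewrite /psmul !big_ord_recl big_ord0 /= beta0.
by rewrite /bump /= /subn /=; lra.
Qed.

Lemma beta2 : beta 2 = 1 / 12.
Proof.
have := beta_riccati 1; rewrite /psmul !big_ord_recl big_ord0 /= beta0.
by rewrite /bump /= /subn /= ?beta0 ?beta1; lra.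
Qed.

(** The convolution terms with a factor of index 0 or 1 are split off; those with [beta 1] = -1/2
    cancel the summand [beta n.+2] of the Riccati equation. *)
Lemma beta_rec n : n.+4%:R * beta n.+3
  = - \sum_(k < n) beta k.+2 * beta (n - k).+1.
Proof.
have := beta_riccati n.+2.
rewrite /psmul; do 2!rewrite big_ord_recl; do 2!rewrite big_ord_recr.
rewrite /= beta0 /bump /= subn0 subnn subSnn beta0 beta1 subn1 -(natr1 n.+3) /=.
under eq_bigr => k _ do rewrite !add1n !subSS subSn 1?ltnW //.
set S := \sum_(k < n) _ => eqS; move: eqS.
set b3 := beta n.+3; set b2 := beta n.+2; set c := n.+3%:R.
by move: S b3 b2 c => S b3 b2 c; lra.
Qed.

(** In [beta_rec] at an odd index, each product has a factor of smaller odd index at least 3. *)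
Lemma beta_odd n : beta (2 * n).+3 = 0.
Proof.
elim/ltn_ind: n => n IHn; apply: (@mulfI _ (2 * n).+4%:R).
  by rewrite pnatr_eq0.
rewrite mulr0 beta_rec; apply/eqP; rewrite oppr_eq0 big1 // => k _.
have lt_k := ltn_ord k; have := odd_double_half k.
case: (odd k) => /= kE; rewrite -muln2 in kE.
  have -> : (k.+2 = (2 * k./2).+3)%N by lia.
  by rewrite IHn ?mul0r //; lia.
have -> : ((2 * n - k).+1 = (2 * (n - k./2).-1).+3)%N by lia.
by rewrite IHn ?mulr0 //; lia.
Qed.

Lemma sum_ord_even (F : nat -> rat) n : (forall k, F k.*2.+1 = 0) ->
  \sum_(k < n.*2.+1) F k = \sum_(i < n.+1) F i.*2.
Proof.
move=> F0; elim: n => [|n IHn]; first by rewrite !big_ord_recl !big_ord0.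
by rewrite doubleS 2!big_ord_recr /= IHn F0 addr0 [RHS]big_ord_recr.
Qed.

(* gamma n = |B_(2n+2)| / (2n+2)!, see gamma_gt0.  It is locked because
   conversion would evaluate closed instances in unary arithmetic. *)
HB.lock Definition gamma (n : nat) : rat := (-1) ^+ n * beta n.+1.*2.

Lemma gammaE n : gamma n = (-1) ^+ n * beta n.+1.*2.
Proof. by rewrite gamma.unlock. Qed.

Lemma gamma0 : gamma 0 = 1 / 12.
Proof. by rewrite gammaE expr0 mul1r beta2. Qed.

Lemma betaE n : beta n.+1.*2 = (-1) ^+ n * gamma n.
Proof. by rewrite gammaE signrMK. Qed.

(** Euler's recursion: in [beta_rec] only factors of even index survive, and all products carry the
    same sign. *)
Lemma gamma_rec n :
  (2 * n + 5)%:R * gamma n.+1 = \sum_(i < n.+1) gamma i * gamma (n - i).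
Proof.
have := beta_rec n.*2.+1.
rewrite (@sum_ord_even (fun k => beta k.+2 * beta (n.*2.+1 - k).+1)) => [|k]; last first.
  by rewrite -mul2n beta_odd mul0r.
have -> : n.*2.+4 = n.+2.*2 by rewrite !doubleS.
rewrite betaE => gE.
have -> : (2 * n + 5 = n.*2.+1.+4)%N by lia.
apply: (@mulfI _ ((-1) ^+ n.+1)); first by rewrite signr_eq0.
rewrite mulrCA gE exprS mulN1r mulNr mulr_sumr; congr (- _).
apply: eq_bigr => i _; rewrite -(doubleS i) betaE.
have le_in : (i <= n)%N by rewrite -ltnS.
have -> : ((n.*2.+1 - i.*2).+1 = (n - i).+1.*2)%N by lia.
rewrite betaE mulrACA -exprD subnKC //.
Qed.

Lemma gamma_gt0 n : 0 < gamma n.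
Proof.
elim/ltn_ind: n => -[|n] IHn; first by rewrite gamma0; lra.
have coef_gt0 : 0 < (2 * n + 5)%:R :> rat by rewrite ltr0n addnS.
rewrite -(pmulr_rgt0 _ coef_gt0) gamma_rec big_ord_recl /=.
rewrite ltr_wpDr ?sumr_ge0 // => [i _|]; last by rewrite mulr_gt0 ?IHn ?subn0.
by have lt_in := ltn_ord i; rewrite ltW // mulr_gt0 ?IHn // /bump /= ?add1n ?ltnS; lia.
Qed.

Lemma gamma1 : gamma 1 = 1 / 720.
Proof.
have := gamma_rec 0; rewrite big_ord1 subn0 muln0 gamma0.
move: (gamma 1) => x; lra.
Qed.

Lemma gamma2 : gamma 2 = 1 / (42 * 720).
Proof.
have := gamma_rec 1; rewrite big_ord_recl big_ord1 subn0 subnn gamma0 gamma1.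
by move: (gamma 2) => x; lra.
Qed.

(* 1 / 42 is slightly below the limit 1 / (4 pi^2) of the ratio; the induction
   closes because the outer terms of the convolution are kept exactly. *)
Lemma gamma_ratio n : gamma n.+1 <= 42 * gamma n.+2.
Proof.
elim/ltn_ind: n => -[|n] IHn; first by rewrite gamma1 gamma2; lra.
have := gamma_rec n.+2; have := gamma_rec n.+1.
rewrite big_ord_recl big_ord_recr /= subnn gamma0 subn0.
rewrite big_ord_recl big_ord_recl big_ord_recr /= subnn subn0 gamma0.
rewrite /bump /= !add1n gamma1.
have -> : (n.+2 - 1 = n.+1)%N by lia.
have le_mid : \sum_(i < n) gamma (1 + i) * gamma (n.+1 - (1 + i))
    <= 42 * (\sum_(i < n) gamma (1 + (1 + i)) * gamma (n.+2 - (1 + (1 + i)))).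
  rewrite mulr_sumr; apply: ler_sum => i _; have lt_in := ltn_ord i.
  rewrite !add1n !subSS mulrA ler_wpM2r ?IHn ?ltW ?gamma_gt0 //; lia.
have := IHn n (ltnSn n); move: le_mid.
have -> : (2 * n.+1 + 5)%:R = 2 * n%:R + 7 :> rat.
  by rewrite natrD natrM -natr1; ring.
have -> : (2 * n.+2 + 5)%:R = 2 * n%:R + 9 :> rat.
  by rewrite natrD natrM -natr1 -natr1; ring.
set M1 := \sum_(i < n) _; set M2 := \sum_(i < n) _.
have : (0 : rat) <= n%:R by rewrite ler0n.
have := gamma_gt0 n.+1; have := gamma_gt0 n.+2.
move: M1 M2 n%:R (gamma n.+1) (gamma n.+2) (gamma n.+3) => M1 M2 x a b c.
move=> b_gt0 a_gt0 x_ge0 le_mid le_ab recb recc.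
(* After inserting both recursions this reduces to 78/720 a <= 5 b, which follows from a <= 42 b
   since 78 * 42 / 720 < 5. *)
have le_b : (2 * x + 9) * b <= (2 * x + 9) * (42 * c) by lra.
by rewrite ler_pM2l // in le_b; lra.
Qed.

(* absB n = |B_(2n+2)| *)
HB.lock Definition absB (n : nat) : rat := gamma n * (2 * n + 2)`!%:R.

Lemma absBE n : absB n = gamma n * (2 * n + 2)`!%:R.
Proof. by rewrite absB.unlock. Qed.

Lemma absB_gt0 n : 0 < absB n.
Proof. by rewrite absBE mulr_gt0 ?gamma_gt0 // ltr0n fact_gt0. Qed.

Lemma absB_ratio n :
  ((2 * n + 5) * (2 * n + 6))%:R * absB n.+1 <= 42 * absB n.+2.
Proof.
rewrite !absBE; have -> : (2 * n.+2 + 2 = (2 * n.+1 + 2).+2)%N by lia.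
rewrite !factS !natrM.
have -> : (2 * n.+1 + 2).+2 = (2 * n + 6)%N by lia.
have -> : (2 * n.+1 + 2).+1 = (2 * n + 5)%N by lia.
have := gamma_ratio n.
have : (0 : rat) <= ((2 * n + 5) * (2 * n + 6) * (2 * n.+1 + 2)`!)%:R by rewrite ler0n.
rewrite !natrM; move: (_`!%:R) (2 * n + 5)%:R (2 * n + 6)%:R => x y z.
move: (gamma n.+1) (gamma n.+2) => a b h1 h2.
have := ler_wpM2l h1 h2; lra.
Qed.

Lemma bernoulli_even n : bernoulli n.+1.*2 = (-1) ^+ n * absB n.
Proof.
rewrite absBE mulrA -betaE /beta.
have -> : (2 * n + 2 = n.+1.*2)%N by lia.
by rewrite mulfVK // pnatr_eq0 -lt0n fact_gt0.
Qed.

Lemma bernoulli_odd n : bernoulli n.*2.+3 = 0.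
Proof.
apply/eqP; have /eqP := beta_odd n; rewrite -mul2n /beta mulf_eq0 invr_eq0 pnatr_eq0.
by rewrite (gtn_eqF (fact_gt0 _)) orbF.
Qed.

Lemma bernoulli1 : bernoulli 1 = - 1 / 2.
Proof. by rewrite -beta1 /beta divr1. Qed.

(** * Stirling numbers *)

Lemma stirling1_0m m : stirling1 0 m = (m == 0)%:R.
Proof. by rewrite /stirling1 big_ord0 coef1. Qed.

Lemma stirling1_S0 r : stirling1 r.+1 0 = 0.
Proof.
rewrite /stirling1; elim: r => [|r IHr].
  by rewrite big_ord1 addr0 coefX.
by rewrite big_ord_recr /= mulrDr coefD coefMX /= coefMC IHr mul0r addr0.
Qed.

Lemma stirling1_SS r m :
  stirling1 r.+1 m.+1 = r%:R * stirling1 r m.+1 + stirling1 r m.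
Proof.
by rewrite /stirling1 big_ord_recr /= mulrDr coefD coefMX /= coefMC addrC mulrC.
Qed.

Lemma stirling1_ge0 r m : 0 <= stirling1 r m.
Proof.
elim: r m => [|r IHr] [|m]; rewrite ?stirling1_0m ?stirling1_S0 //.
by rewrite stirling1_SS addr_ge0 // mulr_ge0 ?ler0n.
Qed.

Lemma stirling1_small r m : (r < m)%N -> stirling1 r m = 0.
Proof.
elim: r m => [|r IHr] [|m] //; first by rewrite stirling1_0m.
by rewrite ltnS => lt_rm; rewrite stirling1_SS !IHr ?mulr0 ?addr0 // ltnW.
Qed.

Lemma stirling1_gt0 r m : (m < r)%N -> 0 < stirling1 r m.+1.
Proof.
elim: r m => // r IHr [_|m lt_mr]; rewrite stirling1_SS.
  case: r IHr => [|r] IHr; first by rewrite mul0r stirling1_0m.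
  by rewrite stirling1_S0 addr0 mulr_gt0 ?IHr.
by rewrite ltr_wpDl ?IHr // mulr_ge0 ?ler0n ?stirling1_ge0.
Qed.

(** In the induction on r, (r + 1) times the bound for m + 1 plus the bound for m leaves the slack r
    [r m+1]. *)
Lemma stirling1_ratio_ge r m :
  (r - m)%:R * stirling1 r m <= (m * r)%:R * stirling1 r m.+1.
Proof.
elim: r m => [|r IHr] m.
  by rewrite sub0n mul0r mulr_ge0 ?stirling1_ge0.
case: m => [|m]; first by rewrite stirling1_S0 mulr0 mul0n mul0r.
case: (ltnP m r) => [lt_mr|le_rm]; last first.
  have -> : (r.+1 - m.+1 = 0)%N by lia.
  by rewrite mul0r mulr_ge0 ?ler0n ?stirling1_ge0.
have [e1 e2] : ((r.+1 - m.+1 = (r - m.+1).+1) /\ (r - m = (r - m.+1).+1))%N by lia.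
have := IHr m; have := IHr m.+1; have := stirling1_ge0 r m.+1.
rewrite !stirling1_SS e1 e2.
have -> : r%:R = (r - m.+1)%:R + m.+1%:R :> rat by rewrite -natrD subnK.
rewrite !natrM -![_.+1%:R]natr1.
have -> : r%:R = (r - m.+1)%:R + m.+1%:R :> rat by rewrite -natrD subnK.
rewrite -![_.+1%:R]natr1.
have : (0 : rat) <= m%:R by rewrite ler0n.
have : (0 : rat) <= (r - m.+1)%:R by rewrite ler0n.
move: (stirling1 r m.+2) (stirling1 r m.+1) (stirling1 r m) => a b c.
move: m%:R (r - m.+1)%:R => x y y_ge0 x_ge0 b_ge0 IH1 IH2.
have := ler_wpM2l (_ : 0 <= y + (x + 1) + 1) IH1.
have yxb : 0 <= (y + (x + 1)) * b by rewrite mulr_ge0 //; lra.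
lra.
Qed.

(** Here r times the bound for m + 1 plus the bound for m leaves the slack 2 (r - m - 1) [r m+1]. *)
Lemma stirling1_ratio_le r m :
  (m * m.+1)%:R * stirling1 r m.+1 <= (2 * (r - m))%:R * stirling1 r m.
Proof.
elim: r m => [|r IHr] m; first by rewrite stirling1_0m mulr0 mulr_ge0 ?stirling1_ge0.
case: m => [|m]; first by rewrite stirling1_S0 mulr0 mul0n mul0r.
case: (ltnP m r) => [lt_mr|le_rm]; last first.
  by rewrite stirling1_small ?mulr0 ?mulr_ge0 ?ler0n ?stirling1_ge0 //; lia.
have [e1 e2] : ((r.+1 - m.+1 = (r - m.+1).+1) /\ (r - m = (r - m.+1).+1))%N by lia.
have := IHr m; have := IHr m.+1; have := stirling1_ge0 r m.+1.
rewrite !stirling1_SS e1 e2.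
have -> : r%:R = (r - m.+1)%:R + m.+1%:R :> rat by rewrite -natrD subnK.
rewrite !natrM -![_.+1%:R]natr1.
have : (0 : rat) <= m%:R by rewrite ler0n.
have : (0 : rat) <= (r - m.+1)%:R by rewrite ler0n.
move: (stirling1 r m.+2) (stirling1 r m.+1) (stirling1 r m) => a b c.
move: m%:R (r - m.+1)%:R => x y y_ge0 x_ge0 b_ge0 IH1 IH2.
have rx_ge0 : 0 <= y + (x + 1) by lra.
have := ler_wpM2l rx_ge0 IH1; have : 0 <= y * b by rewrite mulr_ge0.
lra.
Qed.

(** This is r! times the coefficient of z^r in (-log(1 - z))^m. *)
HB.lock Definition fstirling (r m : nat) : rat := m`!%:R * stirling1 r m.

Lemma fstirlingE r m : fstirling r m = m`!%:R * stirling1 r m.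
Proof. by rewrite fstirling.unlock. Qed.

Lemma fstirling_ge0 r m : 0 <= fstirling r m.
Proof. by rewrite fstirlingE mulr_ge0 ?ler0n ?stirling1_ge0. Qed.

Lemma fstirling_gt0 r m : (m < r)%N -> 0 < fstirling r m.+1.
Proof. by move=> lt_mr; rewrite fstirlingE mulr_gt0 ?stirling1_gt0 // ltr0n fact_gt0. Qed.

Lemma fstirling_small r m : (r < m)%N -> fstirling r m = 0.
Proof. by move=> lt_rm; rewrite !fstirlingE stirling1_small ?mulr0. Qed.

Lemma fstirling_0m m : fstirling 0 m = (m == 0)%:R.
Proof. by rewrite !fstirlingE stirling1_0m; case: m => [|m]; rewrite ?mulr1 ?mulr0. Qed.

Lemma fstirling_S0 r : fstirling r.+1 0 = 0.
Proof. by rewrite !fstirlingE stirling1_S0 mulr0. Qed.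

Lemma fstirling_SS r m :
  fstirling r.+1 m.+1 = r%:R * fstirling r m.+1 + m.+1%:R * fstirling r m.
Proof. by rewrite !fstirlingE stirling1_SS factS natrM; ring. Qed.

(** Since r - m >= r / 2, [stirling1_ratio_ge] gives [r m] <= 2 m [r m+1]. *)
Lemma fstirling_ratio_ge r m : (2 * m <= r)%N -> (0 < m)%N ->
  fstirling r m <= 2 * fstirling r m.+1.
Proof.
move=> le_2mr m_gt0; have := stirling1_ratio_ge r m.
rewrite !fstirlingE factS natrM.
have -> : r = (m + (r - 2 * m) + m)%N by lia.
move: (r - 2 * m)%N => k; rewrite addnK !natrM !natrD.
set M := m%:R; set K := k%:R; rewrite -(natr1 m) -/M.
have M_ge1 : 1 <= M by rewrite ler1n.
have K_ge0 : 0 <= K by rewrite ler0n.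
have := stirling1_ge0 (m + k + m) m; have := stirling1_ge0 (m + k + m) m.+1.
have : (0 : rat) < m`!%:R by rewrite ltr0n fact_gt0.
move: M K (stirling1 _ m.+1) (stirling1 _ m) (m`!%:R) M_ge1 K_ge0.
move=> M K a b F M1 K0 F0 a0 b0 H.
have : (M + K) * b <= (M + K) * (M * 2 * a).
  apply: le_trans H _; have : 0 <= M * K * a by rewrite !mulr_ge0 //; lra.
  lra.
rewrite ler_pM2l; last lra.
move=> H1; have : b <= 2 * ((M + 1) * a) by lra.
by move/(ler_wpM2l (ltW F0)); lra.
Qed.

(** Since r - m <= m + 1, [stirling1_ratio_le] gives m [r m+1] <= 2 [r m]. The ratio 18/5 is what
    [absorb_negative] can afford. *)
Lemma fstirling_ratio_le r m : (r <= m.*2.+1)%N -> (10 <= m)%N ->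
  5 * fstirling r m.+1 <= 18 * fstirling r m.
Proof.
move=> le_r2m m_ge10; have := stirling1_ratio_le r m.
rewrite !fstirlingE factS natrM.
have : (r - m)%:R <= m.+1%:R :> rat by rewrite ler_nat; lia.
have := stirling1_ge0 r m; rewrite !natrM -(natr1 m).
have : (10%:R : rat) <= m%:R by rewrite ler_nat.
have : (0 : rat) < m`!%:R by rewrite ltr0n fact_gt0.
move: (stirling1 r m.+1) (stirling1 r m) m`!%:R m%:R (r - m)%:R => a b F M K.
move=> F0 M10 b0 KM H.
have Ma : M * (M + 1) * a <= (M + 1) * (2 * b).
  by apply: le_trans H _; have := ler_wpM2r b0 KM; lra.
have {Ma} : M * a <= 2 * b by rewrite -mulrA mulrCA ler_pM2l in Ma; lra.
move=> Ma; have : 5 * ((M + 1) * a) <= 18 * b.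
  case: (lerP a 0) => a0; last first.
    by have := ler_wpM2r (ltW a0) M10; lra.
  by have := mulr_ge0_le0 (_ : 0 <= M + 1) a0; lra.
by move/(ler_wpM2l (ltW F0)); lra.
Qed.

(** * The convolution coefficients *)

Definition even_term (n : nat) : rat :=
  gamma n * (absB n - (-1) ^+ n) / (2 * n + 2)%:R.

Lemma bern_egf1 : bern_egf 1 = - 1 / 4.
Proof. by rewrite /bern_egf /bern_term bernoulli1 !divr1 expr1; lra. Qed.

Lemma bern_egf_odd n : bern_egf n.*2.+3 = 0.
Proof. by rewrite /bern_egf /bern_term bernoulli_odd !mul0r. Qed.

Lemma bern_egf_even n : bern_egf n.+1.*2 = - even_term n.
Proof.
have -> : n.+1.*2 = (2 * n + 2)%N by lia.
have := bernoulli_even n; have -> : n.+1.*2 = (2 * n + 2)%N by lia.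
rewrite /even_term /bern_egf /bern_term => ->.
have -> : (-1) ^+ (2 * n + 2) = 1 :> rat.
  by rewrite exprD exprM sqrrN !expr1n mul1r.
rewrite mul1r {1}absBE.
have : (2 * n + 2)`!%:R != 0 :> rat by rewrite pnatr_eq0 -lt0n fact_gt0.
have : (2 * n + 2)%:R != 0 :> rat by rewrite pnatr_eq0 addnS.
have := sqrr_sign rat n.
move: (gamma n) (absB n) ((-1) ^+ n) (2 * n + 2)%:R (_`!%:R).
move=> g b s x y ss x0 y0.
have -> : s * (g * y) / x * (1 - s * b) / y = (s * g - s ^+ 2 * g * b) / x.
  by field; rewrite x0 y0.
by rewrite ss; field.
Qed.

(** One index of each pair is odd, and index 1 is the only odd one with a nonzero value; it occurs
    twice. *)
Lemma inner_coef_odd n : inner_coef n.*2.+3 = even_term n / 4.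
Proof.
rewrite inner_coefE !eqSS /=.
do 2!rewrite big_ord_recl; do 2!rewrite big_ord_recr.
rewrite /= /bump /= !add1n bern_egf0 subn1 subSnn bern_egf1 bern_egf_odd /=.
rewrite -doubleS bern_egf_even big1 => [|k _].
  by move: (even_term n) => d; lra.
rewrite !add1n; have lt_k := ltn_ord k; have := odd_double_half k.
case: (odd k) => kE.
  have -> : k.+2 = k./2.*2.+3 by lia.
  by rewrite bern_egf_odd mul0r.
have -> : (n.*2.+3 - k.+2 = (n - k./2).-1.*2.+3)%N by lia.
by rewrite bern_egf_odd mulr0.
Qed.

(** A pair of odd indices of sum at least 4 contains one that is at least 3, so only pairs of even
    indices contribute. *)
Lemma inner_coef_even n : inner_coef n.+2.*2
  = 1 / 2 * \sum_(k < n.+1) even_term k * even_term (n - k).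
Proof.
rewrite inner_coefE !doubleS !eqSS /=.
pose F i := bern_egf i * bern_egf (n.*2.+4 - i).
have F_odd k : F k.*2.+1 = 0.
  rewrite /F; case: k => [|k]; last by rewrite doubleS bern_egf_odd mul0r.
  by rewrite subn1 bern_egf_odd mulr0.
rewrite (@sum_ord_even F n.+2 F_odd) big_ord_recl big_ord_recr /=.
rewrite /F bern_egf0 !mul0r /bump /= add1n -!doubleS subnn bern_egf0 mulr0.
rewrite subrr !add0r addr0; congr (_ * _).
apply: eq_bigr => k _; rewrite add1n bern_egf_even -doubleB subSS subSn.
  by rewrite bern_egf_even mulrNN.
by rewrite -ltnS.
Qed.

Lemma inner_coef0 : inner_coef 0 = 0.
Proof. by rewrite inner_coefE big_ord1 bern_egf0 /= !mul0r; lra. Qed.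

Lemma inner_coef1 : inner_coef 1 = 1 / 4.
Proof.
rewrite inner_coefE !big_ord_recl big_ord0 /= subnn bern_egf0.
by rewrite mul0r; move: (bern_egf _) => x; lra.
Qed.

Lemma inner_coef2 : inner_coef 2 = 1 / 96.
Proof.
rewrite inner_coefE !big_ord_recl big_ord0 /= bern_egf0 /bump /= !add1n subSnn.
by rewrite mul0r mulr0 bern_egf1; lra.
Qed.

(** * Binary evaluation *)

(** The map along which computations with binary integers and fractions are transported to [rat]. *)
Definition rat_of_Z (z : BinNums.Z) : rat := (ssrZ.int_of_Z z)%:~R.

Lemma rat_of_ZD x y : rat_of_Z (BinInt.Z.add x y) = rat_of_Z x + rat_of_Z y.
Proof. by rewrite /rat_of_Z -rmorphD /=; congr (_%:~R); lia. Qed.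

Lemma rat_of_ZM x y : rat_of_Z (BinInt.Z.mul x y) = rat_of_Z x * rat_of_Z y.
Proof. by rewrite /rat_of_Z -rmorphM /=; congr (_%:~R); lia. Qed.

Lemma rat_of_ZN x : rat_of_Z (BinInt.Z.opp x) = - rat_of_Z x.
Proof. by rewrite /rat_of_Z -rmorphN /=; congr (_%:~R); lia. Qed.

Lemma rat_of_Z_nat n : rat_of_Z (BinInt.Z.of_nat n) = n%:R.
Proof. by rewrite /rat_of_Z -[RHS]/(n%:Z%:~R); congr (_%:~R); lia. Qed.

Lemma rat_of_Z_le x y : (rat_of_Z x <= rat_of_Z y) = BinInt.Z.leb x y.
Proof. by rewrite /rat_of_Z ler_int; lia. Qed.

Lemma rat_of_Z_lt x y : (rat_of_Z x < rat_of_Z y) = BinInt.Z.ltb x y.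
Proof. by rewrite /rat_of_Z ltr_int; lia. Qed.

Definition rat_of_Q (q : QArith_base.Q) : rat :=
  rat_of_Z (QArith_base.Qnum q) / rat_of_Z (BinNums.Zpos (QArith_base.Qden q)).

Lemma rat_of_Zpos_gt0 p : 0 < rat_of_Z (BinNums.Zpos p).
Proof. by rewrite -[0]/(rat_of_Z BinNums.Z0) rat_of_Z_lt. Qed.

Lemma rat_of_Zpos_neq0 p : rat_of_Z (BinNums.Zpos p) != 0.
Proof. by rewrite gt_eqF ?rat_of_Zpos_gt0. Qed.

Lemma rat_of_QD p q : rat_of_Q (QArith_base.Qplus p q) = rat_of_Q p + rat_of_Q q.
Proof.
case: p q => [a b] [c d]; rewrite /rat_of_Q /= !rat_of_ZD !rat_of_ZM.
rewrite -[BinNums.Zpos (BinPos.Pos.mul _ _)]/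
  (BinInt.Z.mul (BinNums.Zpos b) (BinNums.Zpos d)).
by rewrite rat_of_ZM addf_div ?rat_of_Zpos_neq0.
Qed.

Lemma rat_of_QM p q : rat_of_Q (QArith_base.Qmult p q) = rat_of_Q p * rat_of_Q q.
Proof.
case: p q => [a b] [c d]; rewrite /rat_of_Q /= !rat_of_ZM.
rewrite -[BinNums.Zpos (BinPos.Pos.mul _ _)]/
  (BinInt.Z.mul (BinNums.Zpos b) (BinNums.Zpos d)).
by rewrite rat_of_ZM mulf_div.
Qed.

Lemma rat_of_QB p q : rat_of_Q (QArith_base.Qminus p q) = rat_of_Q p - rat_of_Q q.
Proof.
by rewrite rat_of_QD; case: q => [c d]; rewrite /rat_of_Q /= rat_of_ZN mulNr.
Qed.

Lemma rat_of_Q_red q : rat_of_Q (Qreduction.Qred q) = rat_of_Q q.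
Proof.
have := Qreduction.Qred_correct q; rewrite /QArith_base.Qeq /rat_of_Q.
move: (Qreduction.Qred q) => p /(congr1 rat_of_Z); rewrite !rat_of_ZM => e.
by apply/eqP; rewrite eqr_div ?rat_of_Zpos_neq0 // e.
Qed.

Lemma rat_of_Q_ge0 q : BinInt.Z.leb BinNums.Z0 (QArith_base.Qnum q) -> 0 <= rat_of_Q q.
Proof.
by rewrite -rat_of_Z_le => num_ge0; rewrite divr_ge0 // ltW ?rat_of_Zpos_gt0.
Qed.

Lemma rat_of_Q_gt0 q : BinInt.Z.ltb BinNums.Z0 (QArith_base.Qnum q) -> 0 < rat_of_Q q.
Proof. by rewrite -rat_of_Z_lt => num_gt0; rewrite divr_gt0 // rat_of_Zpos_gt0. Qed.

Definition Q_of_Z (z : BinNums.Z) : QArith_base.Q := QArith_base.Qmake z BinNums.xH.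

Definition Q_of_nat (n : nat) : QArith_base.Q := Q_of_Z (BinInt.Z.of_nat n).

Definition Qinv_nat (n : nat) : QArith_base.Q :=
  QArith_base.Qmake (BinNums.Zpos BinNums.xH) (BinPos.Pos.of_nat n).

Lemma rat_of_Q_of_Z z : rat_of_Q (Q_of_Z z) = rat_of_Z z.
Proof. by rewrite /rat_of_Q /= divr1. Qed.

Lemma rat_of_Q_of_nat n : rat_of_Q (Q_of_nat n) = n%:R.
Proof. by rewrite rat_of_Q_of_Z rat_of_Z_nat. Qed.

Lemma rat_of_Qinv_nat n : rat_of_Q (Qinv_nat n.+1) = n.+1%:R^-1.
Proof.
rewrite /rat_of_Q -rat_of_Z_nat.
have -> : BinInt.Z.of_nat n.+1 = BinNums.Zpos (BinPos.Pos.of_nat n.+1) by lia.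
by rewrite [rat_of_Z (QArith_base.Qnum _)]/(1%:~R) mul1r.
Qed.

(** Reducing after every addition keeps the fractions small. *)
Definition Qdot (s t : seq QArith_base.Q) : QArith_base.Q :=
  foldr (fun p acc => Qreduction.Qred
      (QArith_base.Qplus (QArith_base.Qmult p.1 p.2) acc))
    (Q_of_nat 0) (zip s t).

Lemma rat_of_Qdot n s t : size s = n -> size t = n ->
  rat_of_Q (Qdot s t)
  = \sum_(i < n) rat_of_Q (nth (Q_of_nat 0) s i) * rat_of_Q (nth (Q_of_nat 0) t i).
Proof.
elim: n s t => [|n IHn] [|x s] [|y t] //=.
  by rewrite big_ord0 rat_of_Q_of_nat.
move=> [s_n] [t_n]; rewrite rat_of_Q_red rat_of_QD rat_of_QM -/(Qdot s t).
by rewrite (IHn s t) // big_ord_recl.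
Qed.

(** Euler's recursion solved for its left-hand side; [2 * n + 3] is the factor of [gamma_rec] at n -
    1, and [rev] produces the convolution. *)
Definition gamma_next (n : nat) (s : seq QArith_base.Q) : QArith_base.Q :=
  if n is 0 then Qinv_nat 12
  else Qreduction.Qred (QArith_base.Qmult (Qinv_nat (2 * n + 3)) (Qdot s (rev s))).

Fixpoint gamma_seq (n : nat) : seq QArith_base.Q :=
  if n is k.+1 then let s := gamma_seq k in rcons s (gamma_next k s) else [::].

Lemma size_gamma_seq n : size (gamma_seq n) = n.
Proof. by elim: n => //= n IHn; rewrite size_rcons IHn. Qed.

Lemma rat_of_gamma_next n s : size s = n ->
  (forall i, (i < n)%N -> rat_of_Q (nth (Q_of_nat 0) s i) = gamma i) ->
  rat_of_Q (gamma_next n s) = gamma n.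
Proof.
case: n => [|n] size_s sE; first by rewrite rat_of_Qinv_nat gamma0 mul1r.
rewrite rat_of_Q_red rat_of_QM addnS rat_of_Qinv_nat (@rat_of_Qdot n.+1) ?size_rev //.
apply: (@mulfI _ (2 * n + 5)%:R); first by rewrite pnatr_eq0 addnS.
rewrite gamma_rec mulrA; have -> : ((2 * n.+1 + 2).+1 = 2 * n + 5)%N by lia.
rewrite mulfV ?mul1r; last by rewrite pnatr_eq0 addnS.
apply: eq_bigr => j _; have lt_jn := ltn_ord j.
by rewrite nth_rev size_s // subSS !sE // ltnS leq_subr.
Qed.

Lemma nth_gamma_seq n i : (i < n)%N ->
  rat_of_Q (nth (Q_of_nat 0) (gamma_seq n) i) = gamma i.
Proof.
elim: n i => // n IHn i; rewrite ltnS leq_eqVlt /= nth_rcons size_gamma_seq.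
case/orP=> [/eqP ->|lt_in]; last by rewrite lt_in IHn.
by rewrite ltnn eqxx rat_of_gamma_next ?size_gamma_seq.
Qed.

Fixpoint Zfact (n : nat) : BinNums.Z :=
  if n is k.+1 then BinInt.Z.mul (BinInt.Z.of_nat n) (Zfact k) else BinInt.Z.of_nat 1.

Lemma rat_of_Zfact n : rat_of_Z (Zfact n) = n`!%:R.
Proof.
elim: n => [|n IHn]; first by rewrite rat_of_Z_nat.
rewrite -[Zfact _]/(BinInt.Z.mul (BinInt.Z.of_nat n.+1) (Zfact n)) rat_of_ZM.
by rewrite rat_of_Z_nat IHn factS natrM.
Qed.

Definition even_term_Q (n : nat) (g : QArith_base.Q) : QArith_base.Q :=
  Qreduction.Qred (QArith_base.Qmult (Qinv_nat (2 * n + 2)) (QArith_base.Qmult g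
    (QArith_base.Qminus (QArith_base.Qmult g (Q_of_Z (Zfact (2 * n + 2))))
      (if odd n then QArith_base.Qminus (Q_of_nat 0) (Q_of_nat 1) else Q_of_nat 1)))).

Lemma rat_of_even_term_Q n g : rat_of_Q g = gamma n ->
  rat_of_Q (even_term_Q n g) = even_term n.
Proof.
move=> gE; rewrite rat_of_Q_red !(rat_of_QM, rat_of_QB) rat_of_Q_of_Z rat_of_Zfact gE.
rewrite /even_term absBE -signr_odd mulrC.
have -> : (2 * n + 2 = (2 * n + 1).+1)%N by lia.
rewrite rat_of_Qinv_nat.
by case: (odd n); rewrite ?rat_of_QB !rat_of_Q_of_nat ?expr1 ?expr0 ?sub0r.
Qed.

Definition even_term_seq (n : nat) : seq QArith_base.Q :=
  let s := gamma_seq n in mkseq (fun i => even_term_Q i (nth (Q_of_nat 0) s i)) n.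

Lemma size_even_term_seq n : size (even_term_seq n) = n.
Proof. exact: size_mkseq. Qed.

Lemma nth_even_term_seq n i : (i < n)%N ->
  rat_of_Q (nth (Q_of_nat 0) (even_term_seq n) i) = even_term i.
Proof. by move=> lt_in; rewrite nth_mkseq // rat_of_even_term_Q ?nth_gamma_seq. Qed.

(** With h = [k./2], the index k + 3 is 2 h + 4 for odd k and 2 h + 3 for even k, as in
    [inner_coef_even] and [inner_coef_odd]. *)
Definition inner_coef_Q (d : seq QArith_base.Q) (m : nat) : QArith_base.Q :=
  match m with
  | 0 => Q_of_nat 0
  | 1 => Qinv_nat 4
  | 2 => Qinv_nat 96
  | k.+3 =>
    Qreduction.Qred (if odd k then
      let s := take k./2.+1 d in QArith_base.Qmult (Qinv_nat 2) (Qdot s (rev s))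
    else QArith_base.Qmult (nth (Q_of_nat 0) d k./2) (Qinv_nat 4))
  end.

Lemma rat_of_inner_coef_Q n m : (m <= n.*2.+2)%N ->
  rat_of_Q (inner_coef_Q (even_term_seq n) m) = inner_coef m.
Proof.
case: m => [|[|[|k]]] le_mn.
- by rewrite rat_of_Q_of_nat inner_coef0.
- by rewrite rat_of_Qinv_nat inner_coef1 mul1r.
- by rewrite rat_of_Qinv_nat inner_coef2 mul1r.
have le_k := odd_double_half k; rewrite rat_of_Q_red -[in RHS]le_k.
case: (odd k) le_k => /= le_k; last first.
  by rewrite add0n inner_coef_odd rat_of_QM rat_of_Qinv_nat nth_even_term_seq //; lia.
have -> : (1 + k./2.*2).+3 = k./2.+2.*2 by rewrite !doubleS.
have size_take : size (take k./2.+1 (even_term_seq n)) = k./2.+1.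
  by rewrite size_takel // size_even_term_seq; lia.
rewrite inner_coef_even rat_of_QM rat_of_Qinv_nat (@rat_of_Qdot k./2.+1) ?size_rev //.
rewrite mul1r; congr (_ * _); apply: eq_bigr => i _; have lt_i := ltn_ord i.
rewrite nth_rev size_take // subSS !nth_take ?ltnS ?leq_subr //.
by rewrite !nth_even_term_seq //; lia.
Qed.

(** Column m of the next row depends on columns m and m - 1 only, so cutting the rows to n columns
    is exact. *)
Definition fstirling_next (n r : nat) (s : seq BinNums.Z) : seq BinNums.Z :=
  mkseq (fun m => BinInt.Z.add (BinInt.Z.mul (BinInt.Z.of_nat r) (nth BinNums.Z0 s m))
    (if m is k.+1 then BinInt.Z.mul (BinInt.Z.of_nat m) (nth BinNums.Z0 s k)
     else BinNums.Z0)) n.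

Definition is_fstirling_row (n r : nat) (s : seq BinNums.Z) :=
  size s = n /\ forall m, (m < n)%N -> rat_of_Z (nth BinNums.Z0 s m) = fstirling r m.

Lemma fstirling_nextP n r s :
  is_fstirling_row n r s -> is_fstirling_row n r.+1 (fstirling_next n r s).
Proof.
case=> _ sE; split=> [|m lt_mn]; first by rewrite size_mkseq.
rewrite nth_mkseq // rat_of_ZD rat_of_ZM rat_of_Z_nat sE //.
case: m lt_mn => [|m] lt_mn.
  rewrite fstirling_S0 addr0; case: r {sE} => [|r]; first by rewrite mul0r.
  by rewrite fstirling_S0 mulr0.
by rewrite rat_of_ZM rat_of_Z_nat sE 1?ltnW // fstirling_SS.
Qed.

Fixpoint fstirling_row (n r : nat) : seq BinNums.Z :=
  if r is k.+1 then fstirling_next n k (fstirling_row n k)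
  else mkseq (fun m => if m is 0 then BinInt.Z.of_nat 1 else BinNums.Z0) n.

Lemma fstirling_rowP n r : is_fstirling_row n r (fstirling_row n r).
Proof.
elim: r => [|r IHr]; last exact: fstirling_nextP.
split=> [|m lt_mn]; first by rewrite size_mkseq.
by rewrite nth_mkseq // fstirling_0m; case: m {lt_mn}.
Qed.

(* Half of the coefficient of index 41 is kept for the tail. *)
Definition head_coef (m : nat) : rat := if m == 41 then inner_coef m / 2 else inner_coef m.

Definition head_coef_Q : seq QArith_base.Q :=
  let d := even_term_seq 20 in
  mkseq (fun m => let c := inner_coef_Q d m in
    if m == 41 then QArith_base.Qmult c (Qinv_nat 2) else c) 42.

Lemma nth_head_coef_Q m : (m < 42)%N ->
  rat_of_Q (nth (Q_of_nat 0) head_coef_Q m) = head_coef m.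
Proof.
move=> lt_m42; have le_m : (m <= 20.*2.+2)%N by rewrite ltnW.
rewrite nth_mkseq // /head_coef; lazy zeta.
case: eqP => _; rewrite ?rat_of_QM ?rat_of_Qinv_nat (rat_of_inner_coef_Q 20) //.
Qed.

Definition head_sum (r : nat) : rat := \sum_(m < 42) head_coef m * fstirling r m.

Definition Zfloor_scaled (scale : BinNums.Z) (q : QArith_base.Q) : BinNums.Z :=
  BinInt.Z.div (BinInt.Z.mul (QArith_base.Qnum q) scale)
    (BinNums.Zpos (QArith_base.Qden q)).

Lemma rat_of_Zfloor_scaled scale q :
  rat_of_Z (Zfloor_scaled scale q) <= rat_of_Z scale * rat_of_Q q.
Proof.
rewrite /rat_of_Q mulrA ler_pdivlMr ?rat_of_Zpos_gt0 // -!rat_of_ZM rat_of_Z_le.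
apply/ZArith.BinInt.Z.leb_le; rewrite ZArith.BinInt.Z.mul_comm.
rewrite (ZArith.BinInt.Z.mul_comm scale).
exact: ZArith.BinInt.Z.mul_div_le.
Qed.

Definition Zdot (s t : seq BinNums.Z) : BinNums.Z :=
  foldr (fun p acc => BinInt.Z.add (BinInt.Z.mul p.1 p.2) acc) BinNums.Z0 (zip s t).

Lemma rat_of_Zdot n s t : size s = n -> size t = n ->
  rat_of_Z (Zdot s t)
  = \sum_(i < n) rat_of_Z (nth BinNums.Z0 s i) * rat_of_Z (nth BinNums.Z0 t i).
Proof.
elim: n s t => [|n IHn] [|x s] [|y t] //=; first by rewrite big_ord0.
move=> [s_n] [t_n]; rewrite rat_of_ZD rat_of_ZM -/(Zdot s t) (IHn s t) //.
by rewrite big_ord_recl.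
Qed.

(** The weights are nonnegative, so rounding the scaled coefficients down can only lower the sum: an
    integer test suffices. *)
Lemma Zdot_floor_gt0 scale n (c : seq QArith_base.Q) (s : seq BinNums.Z) :
  size c = n -> size s = n ->
  (forall i, (i < n)%N -> 0 <= rat_of_Z (nth BinNums.Z0 s i)) ->
  BinInt.Z.ltb BinNums.Z0 scale ->
  BinInt.Z.ltb BinNums.Z0 (Zdot (map (Zfloor_scaled scale) c) s) ->
  0 < \sum_(i < n) rat_of_Q (nth (Q_of_nat 0) c i) * rat_of_Z (nth BinNums.Z0 s i).
Proof.
move=> c_n s_n s_ge0; rewrite -!rat_of_Z_lt => scale_gt0.
rewrite (@rat_of_Zdot n) ?size_map // => dot_gt0.
rewrite -(pmulr_rgt0 _ scale_gt0); apply: lt_le_trans dot_gt0 _.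
rewrite mulr_sumr; apply: ler_sum => i _; rewrite mulrA ler_wpM2r ?s_ge0 //.
by rewrite (nth_map (Q_of_nat 0)) ?c_n // rat_of_Zfloor_scaled.
Qed.

Fixpoint head_sum_check (c : seq BinNums.Z) (n r : nat) (s : seq BinNums.Z) : bool :=
  if n is k.+1 then
    BinInt.Z.ltb BinNums.Z0 (Zdot c s) && head_sum_check c k r.+1 (fstirling_next 42 r s)
  else true.

Lemma head_sum_check_sound c n r s :
  (forall r' s', is_fstirling_row 42 r' s' ->
     BinInt.Z.ltb BinNums.Z0 (Zdot c s') -> 0 < head_sum r') ->
  is_fstirling_row 42 r s -> head_sum_check c n r s ->
  forall k, (k < n)%N -> 0 < head_sum (r + k).
Proof.
move=> dot_sound; elim: n r s => // n IHn r s s_row /= /andP[dot_gt0 check] [|k] lt_kn.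
  by rewrite addn0; apply: dot_sound dot_gt0.
rewrite addnS -addSn; apply: (IHn _ _ _ check) => //.
exact: fstirling_nextP.
Qed.

Lemma head_sum_dot_sound scale r s : BinInt.Z.ltb BinNums.Z0 scale ->
  is_fstirling_row 42 r s ->
  BinInt.Z.ltb BinNums.Z0 (Zdot (map (Zfloor_scaled scale) head_coef_Q) s) ->
  0 < head_sum r.
Proof.
move=> scale_gt0 [size_s sE] dot_gt0.
have s_ge0 i : (i < 42)%N -> 0 <= rat_of_Z (nth BinNums.Z0 s i).
  by move=> lt_i; rewrite sE ?fstirling_ge0.
have size_c : size head_coef_Q = 42 by exact: size_mkseq.
apply: lt_le_trans (Zdot_floor_gt0 scale 42 _ _ size_c size_s s_ge0 scale_gt0 dot_gt0) _.
apply: ler_sum => i _; have lt_i := ltn_ord i.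
by rewrite (nth_head_coef_Q _ lt_i) (sE _ lt_i).
Qed.

(** A precision at which the integer tests below succeed. *)
Definition scale : BinNums.Z := BinInt.Z.pow (BinInt.Z.of_nat 2) (BinInt.Z.of_nat 80).

Lemma head_sum_gt0_small r : (0 < r)%N -> (r <= 96)%N -> 0 < head_sum r.
Proof.
have scale_gt0 : BinInt.Z.ltb BinNums.Z0 scale by vm_compute.
have check : head_sum_check (map (Zfloor_scaled scale) head_coef_Q)
    96 1 (fstirling_row 42 1).
  by vm_compute.
have sound r' s' := head_sum_dot_sound scale r' s' scale_gt0.
move: check sound.
move: (map _ _) => c check sound.
have {check} := head_sum_check_sound c 96 1 _ sound (fstirling_rowP 42 1) check.
case: r => [|r]; first by [].
move=> all_gt0 _ lt_r; rewrite -add1n; exact: (all_gt0 r lt_r).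
Qed.

(** * Comparison of later rows with row 96 *)

Definition log_concave_at (s : seq BinNums.Z) (m : nat) : bool :=
  let a i := nth BinNums.Z0 s i in
  BinInt.Z.leb (BinInt.Z.mul (BinInt.Z.of_nat m.+1) (BinInt.Z.mul (a m) (a m.+2)))
    (BinInt.Z.mul (BinInt.Z.of_nat m.+2) (BinInt.Z.mul (a m.+1) (a m.+1))).

Lemma log_concave_atP s m : log_concave_at s m ->
  m.+1%:R * (rat_of_Z (nth BinNums.Z0 s m) * rat_of_Z (nth BinNums.Z0 s m.+2))
  <= m.+2%:R * (rat_of_Z (nth BinNums.Z0 s m.+1) * rat_of_Z (nth BinNums.Z0 s m.+1)).
Proof. by rewrite /log_concave_at -rat_of_Z_le !rat_of_ZM !rat_of_Z_nat. Qed.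

(** With the factorials divided out, this is log-concavity of the Stirling numbers [96 m]
    themselves, checked by evaluation. *)
Lemma fstirling96_log_concave m : (m < 40)%N ->
  m.+1%:R * (fstirling 96 m * fstirling 96 m.+2)
  <= m.+2%:R * (fstirling 96 m.+1 * fstirling 96 m.+1).
Proof.
have [_ sE] := fstirling_rowP 42 96.
have check : all (log_concave_at (fstirling_row 42 96)) (iota 0 40) by vm_compute.
move: (fstirling_row _ _) sE check => s sE /allP check lt_m.
have m_in : m \in iota 0 40 by rewrite mem_iota add0n lt_m.
have := log_concave_atP _ _ (check m m_in).
by rewrite !sE //; lia.
Qed.

(** Induction on r from 96; log-concavity is needed for the fixed row 96 only. *)
Lemma fstirling96_step r m : (96 <= r)%N -> (m < 41)%N ->
  fstirling 96 m.+1 * fstirling r m <= fstirling r m.+1 * fstirling 96 m.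
Proof.
have w0 : fstirling 96 0 = 0 by exact: fstirling_S0.
have := fstirling96_log_concave; have : forall m, (m < 41)%N -> 0 < fstirling 96 m.+1.
  by move=> k lt_k; apply: fstirling_gt0; lia.
have := fstirling_ge0 96; move wE: (fstirling 96) w0 => w w0 w_ge0 w_gt0 w_lc.
move=> le_r; rewrite -(subnK le_r); elim: (r - 96)%N m => [|k IHk] m lt_m.
  by rewrite add0n wE mulrC.
rewrite addSn; case: m lt_m => [|m] lt_m; first by rewrite fstirling_S0 mulr0 w0 mulr0.
have := IHk m.+1 lt_m; have := IHk m (ltnW lt_m); rewrite !fstirling_SS.
have := w_lc m lt_m; have := w_gt0 m (ltnW lt_m).
have := w_ge0 m; have := w_ge0 m.+2.
have := fstirling_ge0 (k + 96) m; have := fstirling_ge0 (k + 96) m.+1.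
have : (0 : rat) <= (k + 96)%:R by rewrite ler0n.
have : (0 : rat) <= m.+1%:R by rewrite ler0n.
have : (0 : rat) <= m.+2%:R by rewrite ler0n.
move: (w m) (w m.+1) (w m.+2) (fstirling _ m) (fstirling _ m.+1) (fstirling _ m.+2).
move: m.+1%:R m.+2%:R (_ + _)%:R => x y z a b c f g h.
move=> y0 x0 z0 g0 f0 c0 a0 b0 lc IH1 IH2.
have H2 := ler_wpM2l z0 IH2.
(* What is left after subtracting r times the bound at m + 1. Multiplied by b > 0, it follows from
   the bound at m and log-concavity. *)
suff : x * c * f <= y * b * g by lra.
rewrite -(ler_pM2l b0).
have := ler_wpM2l (mulr_ge0 x0 c0) IH1; have := ler_wpM2l g0 lc.
lra.
Qed.

(** The ratio g / w increases up to index n. Everything is cross-multiplied because [w 0] may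
    vanish, as it does in row 96. *)
Lemma ratio_chain (w g : nat -> rat) n : (forall m, 0 <= w m) ->
  (forall m, (m < n)%N -> 0 < w m.+1) ->
  (forall m, (m < n)%N -> w m.+1 * g m <= g m.+1 * w m) ->
  forall m, (m <= n)%N -> w n * g m <= g n * w m.
Proof.
move=> w_ge0 w_gt0 step m le_m; rewrite -(subKn le_m).
elim: (n - m)%N => [|k IHk]; first by rewrite subn0 mulrC.
have [lt_k|le_k] := ltnP k n; last first.
  by have -> : (n - k.+1 = n - k)%N by lia.
have lt_nk : (n - k.+1 < n)%N by lia.
have := step _ lt_nk; have := w_gt0 _ lt_nk.
have -> : ((n - k.+1).+1 = n - k)%N by lia.
move=> w0 le_step; rewrite -(ler_pM2l w0).
have := ler_wpM2l (w_ge0 n) le_step; have := ler_wpM2r (w_ge0 (n - k.+1)%N) IHk.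
lra.
Qed.

Lemma fstirling96_domination r m : (96 <= r)%N -> (m <= 41)%N ->
  fstirling 96 41 * fstirling r m <= fstirling r 41 * fstirling 96 m.
Proof.
move=> le_r; apply: (ratio_chain (fstirling 96) (fstirling r) 41) => [k|k lt_k|k lt_k].
- exact: fstirling_ge0.
- by apply: fstirling_gt0; apply: ltn_trans lt_k _.
- exact: fstirling96_step.
Qed.

(** * Terms of small index *)

(** Positive coefficients other than the last are dropped, so that the remaining ones can all be
    weighed against index 41. *)
Definition head_neg_Q : seq QArith_base.Q :=
  let s := head_coef_Q in
  mkseq (fun m => let c := nth (Q_of_nat 0) s m in
    if (m == 41) || BinInt.Z.leb (QArith_base.Qnum c) BinNums.Z0 then c else Q_of_nat 0) 42.

Lemma nth_head_neg_Q m : (m < 42)%N ->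
  let c := rat_of_Q (nth (Q_of_nat 0) head_neg_Q m) in
  c <= head_coef m /\ ((m == 41) || (c <= 0)).
Proof.
move=> lt_m; rewrite nth_mkseq //; lazy zeta.
have := nth_head_coef_Q m lt_m; move: (nth _ head_coef_Q m) => q qE.
case: (m == 41) => /=; first by rewrite qE.
case: ifP => [num_le0|/negbT num_gt0].
  have num_le : rat_of_Z (QArith_base.Qnum q) <= 0.
    by rewrite -[0]/(rat_of_Z BinNums.Z0) rat_of_Z_le.
  by rewrite qE -qE /rat_of_Q pmulr_lle0 ?invr_gt0 ?rat_of_Zpos_gt0.
rewrite rat_of_Q_of_nat -qE; split=> //; apply: rat_of_Q_ge0; lia.
Qed.

(** Termwise, w_n h_i g_i >= w_n c_i g_i >= g_n c_i w_i: for i < n because c_i <= 0 reverses the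
    domination, and trivially for i = n. *)
Lemma dominated_sum_gt0 (h c w g : nat -> rat) n : 0 < w n -> 0 < g n ->
  (forall m, 0 <= g m) -> (forall m, (m <= n)%N -> w n * g m <= g n * w m) ->
  (forall m, (m <= n)%N -> c m <= h m /\ ((m == n) || (c m <= 0))) ->
  0 < \sum_(i < n.+1) c i * w i -> 0 < \sum_(i < n.+1) h i * g i.
Proof.
move=> wn_gt0 gn_gt0 g_ge0 dom le_ch sum_gt0.
rewrite -(pmulr_rgt0 _ wn_gt0); apply: lt_le_trans (mulr_gt0 gn_gt0 sum_gt0) _.
rewrite !mulr_sumr; apply: ler_sum => i _; have le_in := ltn_ord i.
rewrite ltnS in le_in; have [le_c c_le0] := le_ch i le_in.
have := ler_wpM2l (mulr_ge0 (ltW wn_gt0) (g_ge0 i)) le_c.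
case/orP: c_le0 => [/eqP ->|c_le0]; first by lra.
by have := ler_wnM2l c_le0 (dom i le_in); lra.
Qed.

Lemma head_sum_gt0_large r : (96 <= r)%N -> 0 < head_sum r.
Proof.
move=> le_r; have lt_41r : (40 < r)%N by apply: leq_trans le_r.
have scale_gt0 : BinInt.Z.ltb BinNums.Z0 scale by vm_compute.
have dot_gt0 : BinInt.Z.ltb BinNums.Z0
    (Zdot (map (Zfloor_scaled scale) head_neg_Q) (fstirling_row 42 96)) by vm_compute.
have [size_s sE] := fstirling_rowP 42 96.
have s_ge0 i : (i < 42)%N -> 0 <= rat_of_Z (nth BinNums.Z0 (fstirling_row 42 96) i).
  by move=> lt_i; rewrite (sE _ lt_i); exact: fstirling_ge0.
have size_c : size head_neg_Q = 42 by exact: size_mkseq.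
apply: (dominated_sum_gt0 _ _ _ _ 41 (fstirling_gt0 96 40 (isT : (40 < 96)%N))
  (fstirling_gt0 r 40 lt_41r) (fstirling_ge0 r)
  (fun m => fstirling96_domination r m le_r) nth_head_neg_Q).
have := Zdot_floor_gt0 scale 42 _ _ size_c size_s s_ge0 scale_gt0 dot_gt0.
rewrite (eq_bigr (fun i : 'I_42 =>
  rat_of_Q (nth (Q_of_nat 0) head_neg_Q i) * fstirling 96 i)) => [sum_gt0|i _].
  exact: sum_gt0.
by rewrite (sE _ (ltn_ord i)).
Qed.

Lemma head_sum_gt0 r : (0 < r)%N -> 0 < head_sum r.
Proof.
by move=> r_gt0; have [/ltnW|] := ltnP 96 r;
  [apply: head_sum_gt0_large|apply: head_sum_gt0_small].
Qed.

(** * Signs and growth of the even terms *)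

Lemma even_term0 : even_term 0 = - 5 / 144.
Proof.
by rewrite /even_term absBE gamma0 muln0 add0n expr0 !factS fact0; lra.
Qed.

(** The terms 2 and 4 are negative, as |B_6| = 1/42 and |B_10| = 5/66 are below 1; the first two
    bounds let the terms 1 and 3 outweigh them. The last one says |B_14| > 1. *)
Lemma even_term_small_facts :
  [/\ 0 <= 5 * even_term 1 + 9 * even_term 2,
      0 <= 5 * even_term 3 + 9 * even_term 4 & 0 < even_term 6].
Proof.
have dE i : (i < 7)%N -> _ := nth_even_term_seq 7 i.
pose c i := nth (Q_of_nat 0) (even_term_seq 7) i.
pose comb i j := QArith_base.Qplus (QArith_base.Qmult (Q_of_nat 5) (c i))
  (QArith_base.Qmult (Q_of_nat 9) (c j)).
have combE i j : (i < 7)%N -> (j < 7)%N ->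
    rat_of_Q (comb i j) = 5 * even_term i + 9 * even_term j.
  by move=> lt_i lt_j; rewrite rat_of_QD !rat_of_QM !rat_of_Q_of_nat /c !dE.
have c12 : BinInt.Z.leb BinNums.Z0 (QArith_base.Qnum (comb 1 2)) by vm_compute.
have c34 : BinInt.Z.leb BinNums.Z0 (QArith_base.Qnum (comb 3 4)) by vm_compute.
have c6 : BinInt.Z.ltb BinNums.Z0 (QArith_base.Qnum (c 6)) by vm_compute.
split.
- by rewrite -(combE 1 2 isT isT); exact: rat_of_Q_ge0 c12.
- by rewrite -(combE 3 4 isT isT); exact: rat_of_Q_ge0 c34.
- by rewrite -(dE 6 isT); exact: rat_of_Q_gt0 c6.
Qed.

Lemma absB_gt1 n : 1 < absB (n + 6).
Proof.
elim: n => [|n IHn].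
  have [_ _] := even_term_small_facts; rewrite /even_term add0n.
  rewrite pmulr_lgt0 ?invr_gt0 // pmulr_rgt0 ?gamma_gt0 // subr_gt0.
  by rewrite -signr_odd expr0.
have := absB_ratio (n + 5).
have le_coef : (42%:R : rat) <= ((2 * (n + 5) + 5) * (2 * (n + 5) + 6))%:R.
  by rewrite ler_nat; nia.
have := ler_wpM2r (ltW (absB_gt0 (n + 6))) le_coef.
rewrite -!addnS addSnnS; lra.
Qed.

(** The product in [absB_ratio] is at least 15 * 16, which exceeds 210 = 5 * 42. *)
Lemma absB_growth n : 5 * absB (n + 6) <= absB (n + 7).
Proof.
have := absB_ratio (n + 5).
have le_coef : (210%:R : rat) <= ((2 * (n + 5) + 5) * (2 * (n + 5) + 6))%:R.
  by rewrite ler_nat; nia.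
have := ler_wpM2r (ltW (absB_gt0 (n + 6))) le_coef.
rewrite -!addnS; lra.
Qed.

Lemma absB_ge14 n : 14 <= absB (n + 8).
Proof.
have := absB_gt1 n; have := absB_growth n; have := absB_growth n.+1.
rewrite !addSnnS.
by move: (absB (n + 6)) (absB (n + 7)) (absB (n + 8)) => a b c; lra.
Qed.

Lemma even_term_odd_gt0 n : odd n -> 0 < even_term n.
Proof.
move=> odd_n; rewrite /even_term pmulr_lgt0 ?invr_gt0 ?ltr0n ?addnS //.
rewrite pmulr_rgt0 ?gamma_gt0 // -signr_odd odd_n expr1.
by have := absB_gt0 n; lra.
Qed.

Lemma even_term_gt0 n : (5 <= n)%N -> 0 < even_term n.
Proof.
move=> le_n; have [|/negbTE odd_n] := boolP (odd n); first exact: even_term_odd_gt0.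
have le_6n : (6 <= n)%N.
  by rewrite ltn_neqAle le_n andbT; apply: contraFneq odd_n => <-.
rewrite /even_term pmulr_lgt0 ?invr_gt0 ?ltr0n ?addnS //.
rewrite pmulr_rgt0 ?gamma_gt0 // -signr_odd odd_n expr0 subr_gt0.
by rewrite -(subnK le_6n) absB_gt1.
Qed.

Lemma quadratic_growth (F : realFieldType) (x b b' : F) :
  34 <= x -> 14 <= b -> (x - 1) * x * b <= 42 * b' ->
  210 * (b + 1) * x <= 9 * (b' - 1) * (x - 2).
Proof.
move=> x34 b14 ratB; have x2_ge0 : 0 <= x - 2 by lra.
(* This says (x - 1) (x - 2) >= 33 * 32 = 1056, weighted by x b. As 9 * 1056 / 42 exceeds 210 by
   more than 16, and 16 b >= 224 for b >= 14, the remaining terms, at most 219 x, are covered. *)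
have h1 : 0 <= (x - 34) * (x + 31) * (x * b).
  by rewrite !mulr_ge0 //; clear ratB; lra.
have h2 : 0 <= x * (b - 14) by rewrite mulr_ge0 //; clear ratB h1; lra.
by have := ler_wpM2l x2_ge0 ratB; lra.
Qed.

(** With x = 2 n + 4, the signs are replaced by the worst case, -1 on the left and 1 on the right,
    and [quadratic_growth] concludes. The bound 34 is the value of x at n = 15. *)
Lemma weighted_ratio (F : realFieldType) (x g g' b b' s s' : F) :
  34 <= x -> -1 <= s -> s' <= 1 -> 14 <= b -> s <= 1 -> 0 < g' ->
  g <= 42 * g' -> (x - 1) * x * b <= 42 * b' ->
  5 * (g * (b - s) / (x - 2)) <= 9 * (g' * (b' - s') / x).
Proof.
move=> x34 s_ge s'_le b14 s_le g'_gt0 ratG ratB.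
have {ratB} H3 := quadratic_growth _ _ _ _ x34 b14 ratB.
have x2_gt0 : 0 < x - 2 by clear -x34; lra.
have x_gt0 : 0 < x by clear -x34; lra.
rewrite !mulrA ler_pdivrMr // [leRHS]mulrAC ler_pdivlMr //.
have bs_ge0 : 0 <= b - s by clear -b14 s_le; lra.
have H1 := ler_wpM2r bs_ge0 ratG.
have H1' : g' * (b - s) <= g' * (b + 1).
  by rewrite ler_wpM2l ?(ltW g'_gt0) //; clear -s_ge; lra.
have H2 : g' * (b' - 1) <= g' * (b' - s').
  by rewrite ler_wpM2l ?(ltW g'_gt0) //; clear -s'_le; lra.
have {H1 H1'} H1 : g * (b - s) <= 42 * (g' * (b + 1)).
  by clear -H1 H1'; lra.
have {}H1 := ler_wpM2r (ltW x_gt0) H1.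
have {}H2 := ler_wpM2r (ltW x2_gt0) H2.
have {}H3 := ler_wpM2l (ltW g'_gt0) H3.
have {}H1 : 5 * (g * (b - s) * x) <= g' * (210 * (b + 1) * x) by clear -H1; lra.
have {}H2 :
    g' * (9 * (b' - 1) * (x - 2)) <= 9 * (g' * (b' - s') * (x - 2)).
  by clear -H2; lra.
by have := le_trans H1 (le_trans H3 H2); rewrite !mulrA.
Qed.

Lemma even_term_ratio n : (15 <= n)%N -> 5 * even_term n <= 9 * even_term n.+1.
Proof.
move=> le_n; rewrite /even_term.
have le_8n : (8 <= n)%N by lia.
have b14 : 14 <= absB n by rewrite -(subnK le_8n) absB_ge14.
have := gamma_ratio n.-1; have := absB_ratio n.-1.
have -> : n.-1.+2 = n.+1 by lia.
have -> : n.-1.+1 = n by lia.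
have -> : (2 * n.-1 + 5 = 2 * n + 3)%N by lia.
have -> : (2 * n.-1 + 6 = 2 * n + 4)%N by lia.
have -> : (2 * n.+1 + 2 = 2 * n + 4)%N by lia.
rewrite natrM.
have sgn k : -1 <= ((-1) ^+ k : rat) <= 1.
  by rewrite -signr_odd; case: (odd k); rewrite ?expr0 ?expr1; lra.
have /andP[s1 s2] := sgn n; have /andP[s3 s4] := sgn n.+1.
have [x3 x2] : (2 * n + 3)%:R = (2 * n + 4)%:R - 1 :> rat
    /\ (2 * n + 2)%:R = (2 * n + 4)%:R - 2 :> rat.
  by rewrite !natrD; split; lra.
have x34 : (34%:R : rat) <= (2 * n + 4)%:R by rewrite ler_nat; lia.
rewrite x3 x2; have := gamma_gt0 n; have := gamma_gt0 n.+1.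
move: (2 * n + 4)%:R x34 => x x34.
move: ((-1) ^+ n) s1 s2 ((-1) ^+ n.+1) s3 s4 => s s1 s2 s' s3 s4.
move: (gamma n) (gamma n.+1) (absB n.+1) (absB n) b14 => g g' b' b b14 g'0 g0 ratB ratG.
exact: weighted_ratio.
Qed.

(** * Terms of large index *)

(** 9 (a y + b x) >= (5 a + 9 b) x. *)
Lemma pair_ge0 (F : realFieldType) (a b x y : F) :
  0 <= a -> 0 <= 5 * a + 9 * b -> 0 <= x -> 5 * x <= 9 * y -> 0 <= a * y + b * x.
Proof.
move=> a_ge0 ab x_ge0 xy; have := ler_wpM2l a_ge0 xy; have := mulr_ge0 ab x_ge0.
lra.
Qed.

(** The two end terms of the convolution give the bound. At each end, the terms 1, 2 and 3, 4
    combine to nonnegative pairs by [pair_ge0], and the middle has positive factors. The pair 3, 4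
    uses the ratio at n - 4 >= 15. *)
Lemma inner_coef_even_ge n : (19 <= n)%N ->
  - 5 / 144 * even_term n <= inner_coef n.+2.*2.
Proof.
move=> le_n; rewrite inner_coef_even; have [d12 d34 _] := even_term_small_facts.
have d_gt0 := even_term_gt0; have d_ratio := even_term_ratio; have d0 := even_term0.
have d1_gt0 := even_term_odd_gt0 1 isT; have d3_gt0 := even_term_odd_gt0 3 isT.
move: even_term d12 d34 d_gt0 d_ratio d0 d1_gt0 d3_gt0.
move=> d d12 d34 d_gt0 d_ratio d0 d1_gt0 d3_gt0.
have [l nE] : exists l, n = l.+4.+4.+1 by exists (n - 9)%N; lia.
subst n; do 5!rewrite big_ord_recl; do 5!rewrite big_ord_recr.
rewrite /= /bump /= !add1n !subSS !subn0.
have mid_ge0 : 0 <= \sum_(i < l) d (1 + (1 + (1 + (1 + (1 + i)))))%N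
    * d (l.+4.+4.+1 - (1 + (1 + (1 + (1 + (1 + i))))))%N.
  apply: sumr_ge0 => i _; have := ltn_ord i => lt_i.
  by apply: mulr_ge0; apply: ltW; apply: d_gt0; lia.
move: mid_ge0; set mid := \sum_(i < l) _ => mid_ge0.
have [-> -> -> -> ->] : [/\ l.+4 - l = 4, l.+3 - l = 3, l.+2 - l = 2, l.+1 - l = 1
    & l - l = 0]%N by split; lia.
have p12 := pair_ge0 _ _ _ _ _ (ltW d1_gt0) d12
  (ltW (d_gt0 l.+3.+4 isT)) (d_ratio l.+3.+4 _).
have p34 := pair_ge0 _ _ _ _ _ (ltW d3_gt0) d34
  (ltW (d_gt0 l.+1.+4 isT)) (d_ratio l.+1.+4 _).
have {}p12 := p12 ltac:(lia); have {}p34 := p34 ltac:(lia).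
rewrite d0; move: (d l.+1.+4) (d l.+2.+4) (d l.+3.+4) (d l.+4.+4) (d l.+1.+4.+4) p12 p34.
move: (d 1) (d 2) (d 3) (d 4) => d1 d2 d3 d4 y1 y2 y3 y4 y5 p12 p34.
by clear -p12 p34 mid_ge0; lra.
Qed.

(** The constants fit exactly: 2 * 5/144 = 5/9 * 1/8 if the next term absorbs the loss, and 18/5 *
    5/144 = 1/8 if the previous one does. *)
Lemma absorb_negative (F : realFieldType) (w1 w2 w3 c d1 d2 : F) :
  0 <= w1 -> 0 <= w2 -> 0 <= w3 -> 0 <= d1 -> 5 * d1 <= 9 * d2 ->
  - 5 / 144 * d1 <= c -> w2 <= 2 * w3 \/ 5 * w2 <= 18 * w1 ->
  0 <= d1 / 8 * w1 + c * w2 + d2 / 8 * w3.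
Proof.
move=> w1_ge0 w2_ge0 w3_ge0 d1_ge0 d12 c_ge w_cmp.
have hc := ler_wpM2r w2_ge0 c_ge; have h3 := ler_wpM2r w3_ge0 d12.
have h1 := mulr_ge0 d1_ge0 w1_ge0; have h1' := mulr_ge0 d1_ge0 w3_ge0.
case: w_cmp => /(ler_wpM2l d1_ge0) hw; clear -hc h1 h1' h3 hw; lra.
Qed.

(** Half of the last odd coefficient is held in reserve; each step spends it, together with half of
    the next odd one, on the even term between them. At k = 20 the reserve is the half split off by
    [head_coef]. *)
Lemma inner_coef_sum_ge r k : (20 <= k)%N ->
  head_sum r + inner_coef k.*2.+1 / 2 * fstirling r k.*2.+1
  <= \sum_(m < k.*2.+2) inner_coef m * fstirling r m.
Proof.
move=> le_k; rewrite -(subnK le_k); elim: (k - 20)%N => [|n IHn].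
  rewrite add0n /head_sum big_ord_recr [leRHS]big_ord_recr /=.
  rewrite (eq_bigr (fun i : 'I_41 => inner_coef i * fstirling r i)) => [|i _].
    by rewrite /head_coef eqxx; lra.
  by rewrite /head_coef (ltn_eqF (ltn_ord i)).
rewrite addSn doubleS 2!big_ord_recr /=.
set N := (n + 20)%N; rewrite -/N in IHn *.
have le_N : (19 <= N.-1)%N by rewrite /N; lia.
have NE : N = N.-1.+1 by rewrite /N; lia.
have c1 : inner_coef N.*2.+1 = even_term N.-1 / 4.
  by rewrite {1}NE doubleS inner_coef_odd.
have c3 : inner_coef N.*2.+3 = even_term N / 4 by rewrite inner_coef_odd.
have c2 := inner_coef_even_ge N.-1 le_N; rewrite -NE doubleS in c2.
have [le5 le15] : (5 <= N.-1)%N /\ (15 <= N.-1)%N by lia.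
have d_pos := even_term_gt0 N.-1 le5; have d_rat := even_term_ratio N.-1 le15.
rewrite -NE in d_rat; rewrite c1 in IHn; rewrite c3.
(* Otherwise r <= 4 N + 3, which is the hypothesis of [fstirling_ratio_le] at m = 2 N + 1. *)
have w_cmp : fstirling r N.*2.+2 <= 2 * fstirling r N.*2.+3
    \/ 5 * fstirling r N.*2.+2 <= 18 * fstirling r N.*2.+1.
  have [le_r|lt_r] := leqP (2 * N.*2.+2) r; [left|right].
    exact: fstirling_ratio_ge.
  by apply: fstirling_ratio_le; lia.
have := absorb_negative _ _ _ _ _ _ _ (fstirling_ge0 r N.*2.+1) (fstirling_ge0 r N.*2.+2)
  (fstirling_ge0 r N.*2.+3) (ltW d_pos) d_rat c2 w_cmp.
by clear -IHn; lra.
Qed.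

Lemma inner_coef_sum_gt0 r : (0 < r)%N ->
  0 < \sum_(m < r.+1) inner_coef m * fstirling r m.
Proof.
(* Past index r the Stirling numbers vanish, so with k = r + 20 the sum is complete and the reserve
   is zero. *)
move=> r_gt0; have le_k : (20 <= r + 20)%N by lia.
have := inner_coef_sum_ge r _ le_k.
have -> : (r + 20).*2.+2 = (r.+1 + (r + 41))%N by lia.
rewrite big_split_ord /= [X in _ + X <= _]mulrC fstirling_small ?mul0r ?addr0; last lia.
rewrite [X in _ <= _ + X]big1 ?addr0 => [|i _]; last first.
  by rewrite fstirling_small ?mulr0 //; lia.
exact: lt_le_trans (head_sum_gt0 r r_gt0).
Qed.

(** * The coefficient formula *)

Definition P01_arg (i : nat) : {poly rat} :=
  ((-1) ^+ i * bernoulli i.+1 / (i.+1%:R * (i.+1)`!%:R)) *: (power_sum i.+1 - 'X).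

Lemma coef0_P01_arg i : (P01_arg i)`_0 = 0.
Proof. by rewrite coefZ coefB coef0_power_sum coefX subr0 mulr0. Qed.

Lemma coef1_P01_arg i : (P01_arg i)`_1 = (-1) ^+ i.+1 * bern_egf i.+1.
Proof.
rewrite coefZ coefB coef_power_sum coefX bin1 subn0 /bern_egf /bern_term exprS /=.
have : i.+2%:R != 0 :> rat by rewrite pnatr_eq0.
have : i.+1%:R != 0 :> rat by rewrite pnatr_eq0.
have : (i.+1)`!%:R != 0 :> rat by rewrite pnatr_eq0 -lt0n fact_gt0.
move: ((-1) ^+ i) (bernoulli _) i.+1%:R i.+2%:R (_`!%:R) => s b x z y y0 x0 z0.
by field; rewrite x0 y0 z0.
Qed.

Lemma coef2_P01_arg i :
  (P01_arg i)`_2 = bernoulli i.+1 * bernoulli i / (2 * (i.+1)`!%:R).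
Proof.
rewrite coefZ coefB coef_power_sum coefX subr0 subSS subn0 /= mul1r.
have binE : 2 * 'C(i.+2, 2)%:R = i.+2%:R * i.+1%:R :> rat.
  by rewrite -!natrM -(mul_bin_diag i.+2 1) bin1.
have -> : 'C(i.+2, 2)%:R = i.+2%:R * i.+1%:R / 2 :> rat.
  by rewrite -binE mulrAC mulfV ?mul1r // pnatr_eq0.
have : i.+1%:R != 0 :> rat by rewrite pnatr_eq0.
have : i.+2%:R != 0 :> rat by rewrite pnatr_eq0.
have : (i.+1)`!%:R != 0 :> rat by rewrite pnatr_eq0 -lt0n fact_gt0.
have := sqrr_sign rat i.
move: ((-1) ^+ i) (bernoulli i.+1) (bernoulli i) i.+1%:R i.+2%:R (_`!%:R).
move=> s b b' x z y ss y0 z0 x0.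
have -> : b * b' / (2 * y) = s ^+ 2 * b * b' / (2 * y) by rewrite ss mul1r.
by field; rewrite x0 y0 z0.
Qed.

(** The coefficient contains B_m B_(m-1), and for m >= 3 one of these indices is odd and at least
    3. *)
Lemma inner_coef_linear m :
  (-1) ^+ m * (\sum_(i < m) (i.+1 == m)%:R * (P01_arg i)`_2)
  = (m == 1)%:R / 4 - (m == 2)%:R / 48.
Proof.
case: m => [|n]; first by rewrite big_ord0 mulr0 !mul0r subrr.
under eq_bigr do rewrite eqSS.
rewrite (sum_ord_delta _ _ _ (fun i => (P01_arg i)`_2)) ltnSn mul1r coef2_P01_arg.
case: n => [|[|n]].
- by rewrite bernoulli1 bernoulli0 expr1 /= !mulr1; lra.
- have := bernoulli_even 0; rewrite absBE gamma0 expr0 mul1r bernoulli1 => ->.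
  by rewrite muln0 add0n !factS fact0 sqrrN expr1n /=; lra.
rewrite !eqSS /= !mul0r subrr; apply/eqP; rewrite mulf_eq0 signr_eq0 /=.
have := odd_double_half n; case: (odd n) => <-.
  by rewrite add1n -doubleS bernoulli_odd mulr0 mul0r.
by rewrite add0n bernoulli_odd !mul0r.
Qed.

Lemma inner_coef_convolution m :
  (-1) ^+ m * (\sum_(i < m) \sum_(k < m)
    (i.+1 + k.+1 == m)%N%:R * ((P01_arg i)`_1 * (P01_arg k)`_1))
  = \sum_(i < m.+1) bern_egf i * bern_egf (m - i).
Proof.
rewrite [RHS]big_ord_recl bern_egf0 mul0r add0r mulr_sumr; apply: eq_bigr => i _.
have lt_im := ltn_ord i; rewrite /= /bump /= add1n.
(* For i + 1 = m no k fits, which agrees with [bern_egf 0] = 0 on the right. *)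
have [le_i2m|lt_mi2] := leqP i.+2 m; last first.
  have -> : (m - i.+1 = 0)%N by lia.
  rewrite bern_egf0 mulr0 big1 ?mulr0 // => k _.
  by case: eqP => [|_]; rewrite ?mul0r //; lia.
rewrite (eq_bigr (fun k : 'I_m => ((k : nat) == m - i.+2)%N%:R
    * ((P01_arg i)`_1 * (P01_arg k)`_1))) => [|k _]; last first.
  by congr (_%:R * _); congr nat_of_bool; apply/eqP/eqP; lia.
rewrite (sum_ord_delta _ _ _ (fun k => (P01_arg i)`_1 * (P01_arg k)`_1)).
have -> : (m - i.+2 < m)%N by lia.
rewrite !coef1_P01_arg; have -> : (m - i.+2).+1 = (m - i.+1)%N by lia.
rewrite mul1r mulrACA -exprD; have -> : (i.+1 + (m - i.+1) = m)%N by lia.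
by rewrite signrMK.
Qed.

Lemma P01_coef2 r :
  (P01 r)`_2 = 4 ^+ r * \sum_(m < r.+1) inner_coef m * fstirling r m.
Proof.
rewrite coefZ coef_sum; congr (_ * _); apply: eq_bigr => m _.
rewrite coefZ (coef2_exp_sum m (fun i => P01_arg i)) => [|i]; last exact: coef0_P01_arg.
rewrite inner_coefE fstirlingE -inner_coef_linear -inner_coef_convolution.
move: (\sum_(i < m) _ * _) (\sum_(i < m) \sum_(k < m) _) => x y.
by move: ((-1) ^+ m) (stirling1 _ _) (m`!%:R) => a b c; ring.
Qed.

(** * Regrouping over pairs of indices *)

Lemma sum_sym (G : nat -> nat -> rat) n : (forall i j, G i j = G j i) ->
  \sum_(0 <= i < n) \sum_(0 <= j < n) G i j
  = \sum_(0 <= i < n) G i i + 2 * (\sum_(0 <= i < n) \sum_(i.+1 <= j < n) G i j).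
Proof.
move=> Gsym; elim: n => [|n IHn]; first by rewrite !big_geq // mulr0 addr0.
have split_last a : (forall i, i < n -> a i <= n)%N ->
    \sum_(0 <= i < n) \sum_(a i <= j < n.+1) G i j
    = \sum_(0 <= i < n) \sum_(a i <= j < n) G i j + \sum_(0 <= i < n) G i n.
  move=> le_an; rewrite -big_split; apply: eq_big_nat => i /andP[_ lt_in].
  by rewrite big_nat_recr ?le_an.
rewrite [LHS]big_nat_recr // [\sum_(0 <= i < n.+1) G i i]big_nat_recr //=.
rewrite [\sum_(0 <= i < n.+1) \sum_(i.+1 <= j < _) _]big_nat_recr //=.
rewrite [\sum_(n.+1 <= j < n.+1) _]big_geq // addr0.
rewrite (split_last (fun=> 0%N)) // (split_last succn) // IHn big_nat_recr //=.
rewrite [\sum_(0 <= i < n) G n i](eq_bigr (fun j => G j n)); last first.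
  by move=> i _; rewrite Gsym.
by ring.
Qed.

Definition bern_pair (r i j : nat) : rat :=
  stirling1 r (i + j) * 'C(i + j, i)%:R * bern_term i * bern_term j.

Lemma bern_term0 : bern_term 0 = 0.
Proof. by rewrite /bern_term invr0 mulr0 mul0r. Qed.

Lemma bern_pairE r i j :
  bern_pair r i j = (i + j)`!%:R * stirling1 r (i + j) * (bern_egf i * bern_egf j).
Proof.
rewrite /bern_pair -(bin_fact (leq_addr j i)) addKn !natrM /bern_egf.
have : i`!%:R != 0 :> rat by rewrite pnatr_eq0 -lt0n fact_gt0.
have : j`!%:R != 0 :> rat by rewrite pnatr_eq0 -lt0n fact_gt0.
by move=> j0 i0; field; rewrite i0 j0.
Qed.

Lemma bern_pairC r i j : bern_pair r i j = bern_pair r j i.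
Proof. by rewrite !bern_pairE addnC (mulrC (bern_egf i)). Qed.

(** Summation along the diagonals i + j = m; the square also contains pairs with i + j > r, whose
    Stirling number is zero. *)
Lemma sum_bern_pair r :
  \sum_(m < r.+1) (\sum_(i < m.+1) bern_egf i * bern_egf (m - i)) * fstirling r m
  = \sum_(0 <= i < r.+1) \sum_(0 <= j < r.+1) bern_pair r i j.
Proof.
rewrite big_mkord; under [RHS]eq_bigr do rewrite big_mkord.
have diagE (m : 'I_r.+1) :
    (\sum_(i < m.+1) bern_egf i * bern_egf (m - i)) * fstirling r m
    = \sum_(i < r.+1) \sum_(j < r.+1) ((m : nat) == i + j)%N%:R * bern_pair r i j.
  rewrite (big_ord_widen r.+1 (fun i => bern_egf i * bern_egf (m - i))) ?ltn_ord //.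
  rewrite big_mkcond mulr_suml; apply: eq_bigr => i _; rewrite ltnS.
  case: leqP => [le_im|lt_mi]; last first.
    rewrite mul0r big1 // => j _; case: eqP => [mE|]; last by rewrite mul0r.
    by move: lt_mi; rewrite mE; lia.
  rewrite (eq_bigr (fun j : 'I_r.+1 => ((j : nat) == m - i)%N%:R * bern_pair r i j)).
    rewrite (sum_ord_delta _ _ _ (bern_pair r i)).
    rewrite (leq_ltn_trans (leq_subr i m)) ?ltn_ord //.
    by rewrite mul1r bern_pairE subnKC // fstirlingE mulrC.
  by move=> j _; congr (_%:R * _); congr nat_of_bool; apply/eqP/eqP; lia.
rewrite (eq_bigr _ (fun m _ => diagE m)).
rewrite exchange_big; apply: eq_bigr => i _; rewrite exchange_big; apply: eq_bigr => j _ /=.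
rewrite (sum_ord_delta _ _ _ (fun=> bern_pair r i j)).
have [_|lt_rij] := ltnP (i + j) r.+1; first by rewrite mul1r.
by rewrite mul0r /bern_pair stirling1_small // !mul0r.
Qed.

Lemma P01_coef2_explicit r : (0 < r)%N ->
  \sum_(m < r.+1) inner_coef m * fstirling r m
  = 1 / 4 * stirling1 r 1 - 1 / 24 * stirling1 r 2
    + 1 / 2 * (\sum_(1 <= i < (r %/ 2).+1) bern_pair r i i)
    + \sum_(1 <= i < r.+1) \sum_(i.+1 <= j < r.+1) bern_pair r i j.
Proof.
move=> r_gt0.
under eq_bigr => m _ do rewrite inner_coefE mulrDl mulrBl -[1 / 2 * _ * _]mulrA
  -[_ / 4 * _]mulrA -[_ / 48 * _]mulrA.
rewrite big_split /= sumrB -mulr_sumr sum_bern_pair (sum_sym _ _ (bern_pairC r)).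
rewrite (sum_ord_delta _ _ _ (fun m => 4^-1 * fstirling r m)).
rewrite (sum_ord_delta _ _ _ (fun m => 48^-1 * fstirling r m)).
have pair0 j : bern_pair r 0 j = 0 by rewrite /bern_pair bern_term0 mulr0 mul0r.
rewrite ltnS r_gt0 [\sum_(0 <= i < r.+1) bern_pair r i i]big_ltn // pair0 add0r.
rewrite [\sum_(0 <= i < r.+1) \sum_(i.+1 <= j < r.+1) _]big_ltn //.
rewrite [\sum_(1 <= j < r.+1) bern_pair r 0 j]big1 ?add0r => [|j _]; last exact: pair0.
rewrite (@big_cat_nat _ _ _ (r %/ 2).+1 1 r.+1) //=; last by rewrite ltnS leq_div.
(* For 2 i > r the Stirling number [r 2i] is zero. *)
have -> : \sum_((r %/ 2).+1 <= i < r.+1) bern_pair r i i = 0.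
  rewrite big_nat_cond big1 // => i /andP[/andP[lt_i _] _].
  by rewrite /bern_pair stirling1_small ?mul0r //; lia.
(* For r = 1 the index 2 lies outside the sum, but [1 2] = 0. *)
have -> : (2 < r.+1)%N%:R * (48^-1 * fstirling r 2) = 48^-1 * fstirling r 2.
  have [_|lt_r2] := ltnP 2 r.+1; first by rewrite mul1r.
  by rewrite fstirling_small ?mulr0.
rewrite !fstirlingE addr0 mul1r (_ : 1`! = 1) // (_ : 2`! = 2) //.
move: (\sum_(1 <= i < (r %/ 2).+1) _) (\sum_(1 <= i < r.+1) _) => x y.
by move: (stirling1 r 1) (stirling1 r 2) => a b; lra.
Qed.

Theorem theorem7p5 (r : nat) (hr : (1 <= r)%N) :
  0 < (P01 r)`_2 /\
  (P01 r)`_2 =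
    4 ^+ r *
    (1 / 4 * stirling1 r 1 - 1 / 24 * stirling1 r 2
     + 1 / 2 * (\sum_(1 <= i < (r %/ 2).+1)
         stirling1 r (2 * i) * 'C(2 * i, i)%:R
         * (bernoulli i / i%:R * (1 - (-1) ^+ i * bernoulli i)) ^+ 2)
     + \sum_(1 <= i < r.+1) \sum_(i.+1 <= j < r.+1)
         stirling1 r (i + j) * 'C(i + j, i)%:R
         * (bernoulli i / i%:R * (1 - (-1) ^+ i * bernoulli i))
         * (bernoulli j / j%:R * (1 - (-1) ^+ j * bernoulli j))).
Proof.
rewrite P01_coef2; split; first by rewrite mulr_gt0 ?exprn_gt0 ?inner_coef_sum_gt0.
rewrite (P01_coef2_explicit r hr); congr (_ * (_ + _ * _ + _)).
by apply: eq_bigr => i _; rewrite /bern_pair addnn -mul2n -mulrA -expr2.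
Qed.
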